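(* Let $E$ be a $T$-universally complete Riesz space with weak order unit $e=Te$, where $T$ is a strictly positive conditional expectation operator on $E$. Let $(T_i^j)$ be a family of conditional expectation operators on $E$ compatible with $T$ such that $\mathcal{R}(T_{i+1}^{j})\subset\mathcal{R}(T_i^j)\subset\mathcal{R}(T_i^{j+1})$ for all $-\infty<i<j<\infty$. Let $p\in\{1,2,\infty\}$ and let $(f_n)_{n\in\mathbb{Z}}\subset\mathcal{L}^\infty(T)$ be near-epoch dependent in $\mathcal{L}^p(T)$ on $(T_i^j)$. If $(T_i^j)$ is $\alpha_T$-mixing or $\varphi_T$-mixing, and $(f_n)_{n\in\mathbb{Z}}$ has $T$-conditional mean zero (that is, $Tf_n=0$ for all $n\in\mathbb{Z}$), then the double sequence $(f_n,T_{-\infty}^n)_{n\in\mathbb{Z}}$ is a mixingale in $\mathcal{L}^1(T)$.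
   Context: Conditional expectation operators. Let $E$ be a Dedekind complete Riesz space with weak order unit. A positive order continuous linear projection $T$ on $E$ whose range $\mathcal{R}(T)$ is a Dedekind complete Riesz subspace of $E$ is a conditional expectation operator if $Te$ is a weak order unit of $E$ for each weak order unit $e$ of $E$. It is strictly positive if $f\ge 0$ and $Tf=0$ imply $f=0$. Another conditional expectation operator $S$ on $E$ is compatible with $T$ if $ST=TS=T$. Multiplication and $T$-universal completeness. A Riesz space is universally complete if it is Dedekind complete and every subset consisting of mutually disjoint elements has a supremum; $E^u$ denotes the universal completion of $E$ (the universally complete Riesz space containing $E$ as an order dense subspace). Given the weak order unit $e=Te$, $E^u$ carries its unique $f$-algebra multiplication with unit $e$; all products are taken in it. $\mathrm{dom}(T)$ is the maximal domain in $E^u$ to which $T$ extends as a conditional expectation operator (the extension is again called $T$); $E$ is $T$-universally complete if $E=\mathrm{dom}(T)$. Spaces and norms. $\mathcal{L}^1(T)=\mathrm{dom}(T)$ ($=E$ here), $\mathcal{L}^2(T)=\{f\in\mathcal{L}^1(T): f^2\in\mathcal{L}^1(T)\}$, $\mathcal{L}^\infty(T)=\{f\in\mathcal{L}^1(T): |f|\le g \text{ for some } g\in\mathcal{R}(T)_+\}$, with $\mathcal{R}(T)_+$-valued norms $\|f\|_{T,1}=T|f|$, $\|f\|_{T,2}=\sqrt{T|f|^2}$ (the positive square root in the multiplication above), $\|f\|_{T,\infty}=\inf\{g\in\mathcal{R}(T)_+: |f|\le g\}$. Near-epoch dependence. With $(T_i^j)$ (indexed by integers $i\le j$) as in the claim,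 $(f_n)_{n\in\mathbb{Z}}\subset\mathcal{L}^p(T)$ is near-epoch dependent in $\mathcal{L}^p(T)$ on $(T_i^j)$ if there exist $(d_n)_{n\in\mathbb{Z}}\subset\mathcal{L}^p(T)_+$ and $(\xi_m)_{m\in\mathbb{N}}\subset\mathcal{R}(T)_+$ with $\xi_m\to0$ in order as $m\to\infty$ such that $\|f_n-T_{n-m}^{n+m}f_n\|_{T,p}\le d_n\xi_m$ for all $n\in\mathbb{Z}$, $m\in\mathbb{N}$ (where $\mathbb{N}=\{1,2,\dots\}$). Mixing. For a conditional expectation operator $S$, $\mathcal{B}(S)$ is the set of band projections $P$ on $E$ with $Pe\in\mathcal{R}(S)$. For conditional expectation operators $U,V$ on $E$ compatible with $T$, $$\alpha_T(U,V)=\sup\{|TPQe-TPe\cdot TQe| : P\in\mathcal{B}(U), Q\in\mathcal{B}(V)\},$$ $$\varphi_T(U,V)=\sup\{\|UQe-TQe\|_{T,\infty} : Q\in\mathcal{B}(V)\}.$$ For a subset $A\subset E$, $\langle A\rangle$ is the smallest Riesz subspace of $E$ containing $A$ that is closed with respect to order limits in $E$. $T_{-\infty}^n$ and $T_n^\infty$ denote the conditional expectation operators on $E$ compatible with $T$ with ranges $\mathcal{R}(T_{-\infty}^n)=\langle\bigcup_{i\le n}\mathcal{R}(T_i^n)\rangle$ and $\mathcal{R}(T_n^\infty)=\langle\bigcup_{j\ge n}\mathcal{R}(T_n^j)\rangle$ (they exist by a known Radon–Nikodým type theorem). For $m\in\mathbb{N}$ put $\alpha_{T,m}=\sup_{n\in\mathbb{Z}}\alpha_T(T_{-\infty}^n,T_{n+m}^\infty)$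 and $\varphi_{T,m}=\sup_{n\in\mathbb{Z}}\varphi_T(T_{-\infty}^n,T_{n+m}^\infty)$. The family is $\alpha_T$-mixing (resp. $\varphi_T$-mixing) if $\alpha_{T,m}\to0$ (resp. $\varphi_{T,m}\to0$) in order as $m\to\infty$. Mixingale. A sequence $(S_n)_{n\in\mathbb{Z}}$ of conditional expectation operators on $E$ is a filtration if $S_mS_n=S_nS_m=S_m$ for $m\le n$. For a filtration $(S_n)_{n\in\mathbb{Z}}$ compatible with $T$ and $(f_n)_{n\in\mathbb{Z}}\subset\mathcal{L}^p(T)$, $(f_n,S_n)_{n\in\mathbb{Z}}$ is a mixingale in $\mathcal{L}^p(T)$ if there exist $(c_n)_{n\in\mathbb{Z}}\subset\mathcal{L}^p(T)_+$ and $(\phi_m)_{m\in\mathbb{N}}\subset\mathcal{R}(T)_+$ with $\phi_m\to0$ in order, such that for all $n\in\mathbb{Z}$, $m\in\mathbb{N}$: (i) $\|S_{n-m}f_n\|_{T,p}\le c_n\phi_m$ and (ii) $\|f_n-S_{n+m}f_n\|_{T,p}\le c_n\phi_{m+1}$. *)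

(* Defs.v *)
From HB Require Import structures.
From mathcomp Require Import all_boot all_order all_algebra.
From mathcomp Require Import all_classical all_reals.

Set Implicit Arguments.
Unset Strict Implicit.
Unset Printing Implicit Defensive.

Import Order.TTheory GRing.Theory Num.Theory.

Local Open Scope classical_set_scope.
Local Open Scope ring_scope.

HB.mixin Record Lmodule_POrder_isRiesz (R : realType) V
    & GRing.Lmodule R V & Num.POrderedZmodule V := {
  rjoin : V -> V -> V ;
  rmeet : V -> V -> V ;
  rjoin_le : forall x y z : V, (rjoin x y <= z) = (x <= z) && (y <= z) ;
  le_rmeet : forall x y z : V, (z <= rmeet x y) = (z <= x) && (z <= y) ;
  riesz_lerD2r : forall z x y : V, x <= y -> x + z <= y + z ;
  riesz_scaler_ge0 : forall (a : R) (x : V), 0 <= a -> 0 <= x -> 0 <= a *: x }.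

#[short(type="rieszType")]
HB.structure Definition Riesz (R : realType) :=
  { V of GRing.Lmodule R V & Num.POrderedZmodule V
       & Lmodule_POrder_isRiesz R V }.

Section RieszSpaces.
Context {R : realType}.
Implicit Types V W : rieszType R.

Definition rabs V (x : V) : V := rjoin x (- x).

Definition disjoint V (x y : V) : Prop := rmeet (rabs x) (rabs y) = 0.

Definition dedekind_complete V : Prop :=
  forall A : set V, has_sup A -> supremums A !=set0.

(* A is nonempty: otherwise the supremum would be a least element of V *)
Definition universally_complete V : Prop :=
  dedekind_complete V /\
  forall A : set V, A !=set0 ->
    (forall x y, A x -> A y -> x <> y -> disjoint x y) -> supremums A !=set0.

Definition weak_order_unit V (u : V) : Prop :=
  0 <= u /\ forall x, disjoint x u -> x = 0.

Record riesz_subspace V (A : set V) : Prop := {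
  riesz_subspace0 : A 0 ;
  riesz_subspaceD : forall x y, A x -> A y -> A (x + y) ;
  riesz_subspaceZ : forall (a : R) x, A x -> A (a *: x) ;
  riesz_subspaceU : forall x y, A x -> A y -> A (rjoin x y) ;
  riesz_subspaceI : forall x y, A x -> A y -> A (rmeet x y) }.

(* Dedekind completeness of A for the induced order: bounds and supremum are  *)
(* taken inside A                                                             *)
Definition dedekind_complete_in V (A : set V) : Prop :=
  forall B : set V, B `<=` A -> B !=set0 -> (A `&` ubound B) !=set0 ->
    exists2 s, (A `&` ubound B) s & lbound (A `&` ubound B) s.

Record directed_preorder (I : Type) (leI : I -> I -> Prop) : Prop := {
  directed_inh : inhabited I ;
  directed_refl : forall i, leI i i ;
  directed_trans : forall i j k, leI i j -> leI j k -> leI i k ;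
  directed_ub : forall i j, exists k, leI i k /\ leI j k }.

Definition order_cvg (I : Type) (leI : I -> I -> Prop) V (x : I -> V) (l : V) :=
  exists u : I -> V,
    [/\ forall i j, leI i j -> u j <= u i,
        infimums (range u) 0
      & forall i, rabs (x i - l) <= u i].

Definition seq_order_cvg V (x : nat -> V) (l : V) : Prop :=
  order_cvg (fun m n : nat => (m <= n)%N) x l.

Definition order_closed V (A : set V) : Prop :=
  forall (I : Type) (leI : I -> I -> Prop) (x : I -> V) (l : V),
    directed_preorder leI -> (forall i, A (x i)) -> order_cvg leI x l -> A l.

Definition order_continuous V W (T : V -> W) : Prop :=
  forall (I : Type) (leI : I -> I -> Prop) (x : I -> V) (l : V),
    directed_preorder leI -> order_cvg leI x l ->
    order_cvg leI (fun i => T (x i)) (T l).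

Definition order_closed_span V (A : set V) : set V :=
  smallest (fun B => riesz_subspace B /\ order_closed B) A.

Record band V (B : set V) : Prop := {
  band_riesz_subspace : riesz_subspace B ;
  band_solid : forall x y, B y -> rabs x <= rabs y -> B x ;
  band_sup : forall (A : set V) s, A `<=` B -> supremums A s -> B s }.

(* the projection along the decomposition V = B (+) B^d, for some band B *)
Definition band_projection V (P : {linear V -> V}) : Prop :=
  exists2 B : set V, band B &
    forall x, B (P x) /\ (forall b, B b -> disjoint (x - P x) b).

Record riesz_embedding V W (j : {linear V -> W}) : Prop := {
  riesz_embedding_inj : injective j ;
  riesz_embeddingU : forall x y, j (rjoin x y) = rjoin (j x) (j y) ;
  riesz_embeddingI : forall x y, j (rmeet x y) = rmeet (j x) (j y) }.

Record universal_completion V W (j : {linear V -> W}) : Prop := {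
  univ_compl_embedding : riesz_embedding j ;
  univ_compl_complete : universally_complete W ;
  univ_compl_dense : forall y, 0 < y -> exists2 x, 0 < j x & j x <= y }.

Record falgebra_mul W (mul : W -> W -> W) (u : W) : Prop := {
  falg_mulA : forall x y z, mul x (mul y z) = mul (mul x y) z ;
  falg_mulDl : forall x y z, mul (x + y) z = mul x z + mul y z ;
  falg_mulDr : forall x y z, mul x (y + z) = mul x y + mul x z ;
  falg_scalel : forall (a : R) x y, mul (a *: x) y = a *: mul x y ;
  falg_scaler : forall (a : R) x y, mul x (a *: y) = a *: mul x y ;
  falg_mul_ge0 : forall x y, 0 <= x -> 0 <= y -> 0 <= mul x y ;
  falg_meetl : forall x y z, rmeet x y = 0 -> 0 <= z ->
    rmeet (mul z x) y = 0 ;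
  falg_meetr : forall x y z, rmeet x y = 0 -> 0 <= z ->
    rmeet (mul x z) y = 0 ;
  falg_mul1l : forall x, mul u x = x ;
  falg_mul1r : forall x, mul x u = x }.

(* to be used on a Dedekind complete space with a weak order unit *)
Record cond_exp V (T : {linear V -> V}) : Prop := {
  cond_exp_ge0 : forall x, 0 <= x -> 0 <= T x ;
  cond_exp_ocont : order_continuous T ;
  cond_exp_idem : forall x, T (T x) = T x ;
  cond_exp_range : riesz_subspace (range T) ;
  cond_exp_range_complete : dedekind_complete_in (range T) ;
  cond_exp_unit : forall u, weak_order_unit u -> weak_order_unit (T u) }.

Definition strictly_positive V (T : {linear V -> V}) : Prop :=
  forall x, 0 <= x -> T x = 0 -> x = 0.

Definition compatible V (T S : {linear V -> V}) : Prop :=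
  forall x, S (T x) = T x /\ T (S x) = T x.

Definition range_ge0 V (T : {linear V -> V}) : set V :=
  [set g | range T g /\ 0 <= g].

Definition filtration V (S : int -> {linear V -> V}) : Prop :=
  (forall n, cond_exp (S n)) /\
  forall m n : int, m <= n ->
    forall x, S m (S n x) = S m x /\ S n (S m x) = S m x.

End RieszSpaces.

Section UniversalDomain.
Context {R : realType} {E Eu : rieszType R}.
Variables (iota : {linear E -> Eu}) (T : {linear E -> E}).

(* D is a domain, inside Eu and containing E, to which T extends as a         *)
(* conditional expectation operator; D is presented as the image of a Riesz   *)
(* space F embedded in Eu                                                     *)
Definition extension_domain (D : set Eu) : Prop :=
  exists (F : rieszType R) (j : {linear F -> Eu}) (S : {linear F -> F}),
    [/\ riesz_embedding j, dedekind_complete F, cond_exp S,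
        forall x, exists2 y, j y = iota x & j (S y) = iota (T x)
      & D = range j].

Definition is_dom (D : set Eu) : Prop :=
  extension_domain D /\ forall D', extension_domain D' -> D' `<=` D.

Definition T_universally_complete : Prop := is_dom (range iota).

End UniversalDomain.

Inductive exponent := Exp1 | Exp2 | ExpInf.

(* In this section E = dom(T), so that L^1(T) is all of E, and E is embedded  *)
(* by iota in its universal completion Eu, where the products are taken.      *)
Section ConditionalSpaces.
Context {R : realType} {E Eu : rieszType R}.
Variables (iota : {linear E -> Eu}) (mul : Eu -> Eu -> Eu).

(* The product of x and y, for x and y whose product in Eu lies in E *)
Definition emul (x y : E) : E :=
  xget 0 [set z | iota z = mul (iota x) (iota y)].

Definition le_mul (x y z : E) : Prop := iota x <= mul (iota y) (iota z).

Variables (T : {linear E -> E}) (e : E).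

Definition Lspace (p : exponent) : set E :=
  match p with
  | Exp1 => setT
  | Exp2 => [set f | exists h, iota h = mul (iota f) (iota f)]
  | ExpInf => [set f | exists2 g, range_ge0 T g & rabs f <= g]
  end.

Definition Lspace_ge0 (p : exponent) : set E :=
  [set f | Lspace p f /\ 0 <= f].

(* The default value 0 of xget and infimum is not reached for f in L^p(T) *)
Definition Tnorm (p : exponent) (f : E) : E :=
  match p with
  | Exp1 => T (rabs f)
  | Exp2 => xget 0 [set s | 0 <= s /\
      mul (iota s) (iota s) = iota (T (emul (rabs f) (rabs f)))]
  | ExpInf => infimum 0 [set g | range_ge0 T g /\ rabs f <= g]
  end.

(* TT i j is T_i^j; the indices m range over the positive naturals *)
Definition near_epoch_dependent (p : exponent) (f : int -> E)
    (TT : int -> int -> {linear E -> E}) : Prop :=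
  (forall n, Lspace p (f n)) /\
  exists (d : int -> E) (xi : nat -> E),
    [/\ forall n, Lspace_ge0 p (d n),
        forall m, (0 < m)%N -> range_ge0 T (xi m),
        seq_order_cvg xi 0
      & forall (n : int) (m : nat), (0 < m)%N ->
          le_mul (Tnorm p (f n - TT (n - m%:Z) (n + m%:Z) (f n))) (d n) (xi m)].

Definition band_projections_of (S : {linear E -> E}) : set {linear E -> E} :=
  [set P : {linear E -> E} | band_projection P /\ range S (P e)].

(* The default value 0 of supremum is not reached below: the products lie     *)
(* between 0 and e, so that all the sets are nonempty and bounded by 2e       *)
Definition alpha_coef (U V : {linear E -> E}) : E :=
  supremum 0 [set x | exists P Q : {linear E -> E},
    [/\ band_projections_of U P, band_projections_of V Q
      & x = rabs (T (P (Q e)) - emul (T (P e)) (T (Q e)))]].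

Definition phi_coef (U V : {linear E -> E}) : E :=
  supremum 0 [set x | exists Q : {linear E -> E},
    band_projections_of V Q /\ x = Tnorm ExpInf (U (Q e) - T (Q e))].

(* Tpast n and Tfuture n are T_{-oo}^n and T_n^{oo} *)
Definition alpha_mixing (Tpast Tfuture : int -> {linear E -> E}) : Prop :=
  seq_order_cvg (fun m => supremum 0
    (range (fun n : int => alpha_coef (Tpast n) (Tfuture (n + m%:Z))))) 0.

Definition phi_mixing (Tpast Tfuture : int -> {linear E -> E}) : Prop :=
  seq_order_cvg (fun m => supremum 0
    (range (fun n : int => phi_coef (Tpast n) (Tfuture (n + m%:Z))))) 0.

Definition mixingale (p : exponent) (f : int -> E)
    (S : int -> {linear E -> E}) : Prop :=
  [/\ filtration S,
      forall n, compatible T (S n),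
      forall n, Lspace p (f n)
    & exists (c : int -> E) (phi : nat -> E),
      [/\ forall n, Lspace_ge0 p (c n),
          forall m, (0 < m)%N -> range_ge0 T (phi m),
          seq_order_cvg phi 0
        & forall (n : int) (m : nat), (0 < m)%N ->
            le_mul (Tnorm p (S (n - m%:Z) (f n))) (c n) (phi m) /\
            le_mul (Tnorm p (f n - S (n + m%:Z) (f n))) (c n) (phi m.+1)]].

End ConditionalSpaces.

Section PastFuture.
Context {R : realType} {E : rieszType R}.
Variables (T : {linear E -> E}) (TT : int -> int -> {linear E -> E}).

Definition is_past (Tpast : int -> {linear E -> E}) : Prop :=
  forall n : int, [/\ cond_exp (Tpast n), compatible T (Tpast n)
    & range (Tpast n) =
      order_closed_span (\bigcup_(i in [set i : int | i <= n]) range (TT i n))].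

Definition is_future (Tfuture : int -> {linear E -> E}) : Prop :=
  forall n : int, [/\ cond_exp (Tfuture n), compatible T (Tfuture n)
    & range (Tfuture n) =
      order_closed_span (\bigcup_(j in [set j : int | n <= j]) range (TT n j))].

End PastFuture.

(* Main.v *)
Require Import Defs.
From HB Require Import structures.
From mathcomp Require Import all_boot all_order all_algebra.
From mathcomp Require Import all_classical all_reals.
From mathcomp Require Import ring lra zify.

(* In the f-algebra Eu the band projections of E are the multiplications by   *)
(* the components c of e (those with c /\ (e - c) = 0), and E is an ideal of  *)
(* Eu because it is Dedekind complete and order dense. Facts about products   *)
(* (commutativity, square roots, Jensen, averaging) are proved by             *)
(* localization: it is enough to check an inequality on components where a    *)
(* given element is constant up to eps. For the mixing bound, let U, V be     *)
(* past and future, x in R(V) with T x = 0 and |x| <= g in R(T). With P the   *)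
(* projection on {U x > 0}, c = P e and h = V c - T c,                        *)
(*   T|U x| = 2 T(P x) = 2 T(x h) <= 2 g T|h|,                                *)
(* and with Q the projection on {h > 0},                                      *)
(*   T|h| = 2 T(Q h) = 2 (T(P Q e) - T(P e) T(Q e)),                          *)
(* which both mixing coefficients control. Apply it to                        *)
(* x = T_{n-k}^{n+k} f_n, k = m/2; the remainder f_n - x is small in L^1      *)
(* because ||.||_{T,1} is below the other norms.                              *)

Set Implicit Arguments.
Unset Strict Implicit.
Unset Printing Implicit Defensive.
Import Order.TTheory GRing.Theory Num.Theory.
Local Open Scope classical_set_scope.
Local Open Scope ring_scope.

(** The [m]-th mixingale bounds come from replacing [f n] by a local approximation
    [x = TT (n - k) (n + k) (f n)], whose L^1 error is at most [d n] times [xi k]: [L1_le_Tnorm]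
    compares the norms, by Jensen ([cexp_sqr]) when [p = 2].

    For condition (ii) take [k = m]. Then [x] lies in the range of [S = Tpast (n + m)], so
    [f n - S (f n) = (f n - x) - S (f n - x)], and the error is at most doubled.

    For condition (i) take [k = m/2] and [U = Tpast (n - m)]. The error term [U (f n - x)] is
    controlled as before. The other term [U x] is small because [x] has mean zero, is bounded by
    some [g n] in R(T), and lies in the range of [Tfuture (n - k)], at distance [m - k] from the
    past [n - m]. This is [mixing_inequality], which bounds [T |U x|] by [4 g a] as soon as [a]
    dominates all the differences [T (P Q e) - T (P e) T (Q e)]; [mixing_bound_alpha] and
    [mixing_bound_phi] obtain such an [a] in R(T) from either coefficient. Hence [c n = d n + g n],
    and [mixingale_seq] collects the factors from R(T).

    Integrals are replaced by algebra in [Eu]. Since [E] is an ideal there ([iota_ideal]), products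
    dominated by elements of [E] stay in [E]. Conditional expectations commute with the projections
    on components of their range ([cexp_cproj]) and, by [localize], satisfy the averaging identity
    [cexp_avg]. Strict positivity turns inclusion of ranges into the tower property ([cexp_tower]),
    which makes the past a filtration. *)

(** * Linear identities in a module, by reflection *)

Section LinearExpressions.
Context {R : realType} {V : lmodType R}.

Inductive lexpr :=
| LVar of nat | LZero | LAdd of lexpr & lexpr | LOpp of lexpr
| LScale of R & lexpr | LMuln of lexpr & nat.

Fixpoint leval (s : seq V) (t : lexpr) : V :=
  match t with
  | LVar i => s`_i
  | LZero => 0
  | LAdd t1 t2 => leval s t1 + leval s t2
  | LOpp t1 => - leval s t1
  | LScale a t1 => a *: leval s t1
  | LMuln t1 n => leval s t1 *+ n
  end.

Fixpoint lcoef (t : lexpr) (i : nat) : R :=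
  match t with
  | LVar j => if eqn i j then 1 else 0
  | LZero => 0
  | LAdd t1 t2 => lcoef t1 i + lcoef t2 i
  | LOpp t1 => - lcoef t1 i
  | LScale a t1 => a * lcoef t1 i
  | LMuln t1 n => lcoef t1 i * n%:R
  end.

Fixpoint lcoefs_eq (t1 t2 : lexpr) (n : nat) : Prop :=
  if n is k.+1 then lcoef t1 k = lcoef t2 k /\ lcoefs_eq t1 t2 k else True.

Lemma levalE s t : leval s t = \sum_(i < size s) lcoef t i *: s`_i.
Proof.
elim: t => [j||t1 IH1 t2 IH2|t IH|a t IH|t IH n] /=.
- have [js|sj] := ltnP j (size s).
    rewrite (bigD1 (Ordinal js)) //= big1 ?addr0; last first.
      by move=> i /negPf ij; rewrite eqnE (ij : (i == j :> nat) = false) scale0r.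
    by rewrite eqnE eqxx scale1r.
  rewrite nth_default // big1 // => i _.
  by rewrite eqnE ltn_eqF ?scale0r// (leq_trans (ltn_ord i)).
- by rewrite big1 // => i _; rewrite scale0r.
- by rewrite IH1 IH2 -big_split; apply: eq_bigr => i _; rewrite scalerDl.
- by rewrite IH -sumrN; apply: eq_bigr => i _; rewrite scaleNr.
- by rewrite IH scaler_sumr; apply: eq_bigr => i _; rewrite scalerA.
- rewrite IH -sumrMnl; apply: eq_bigr => i _.
  by rewrite mulr_natr scalerMnl.
Qed.

(** Comparing coefficients atom by atom is sufficient without any independence of the atoms.
    [lcoefs_eq] unfolds to a finite conjunction of scalar equations, which [ring] or [field]
    settles. *)
Lemma leval_eq s t1 t2 : lcoefs_eq t1 t2 (size s) -> leval s t1 = leval s t2.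
Proof.
rewrite !levalE => H; apply: eq_bigr => -[i /= +] _.
elim: (size s) H => //= n IH [e1 /IH{}IH].
by rewrite ltnS leq_eqVlt => /predU1P[->|/IH//]; rewrite e1.
Qed.

End LinearExpressions.

(* Atoms are compared up to conversion: the coercion of a linear map to a     *)
(* function takes several syntactic forms.                                    *)
Ltac lmod_conv x y :=
  match goal with
  | _ => let _ := match goal with _ => unify x y end in true
  | _ => false
  end.
Ltac lmod_mem x s :=
  lazymatch s with
  | nil => false
  | ?y :: ?s' =>
    let b := lmod_conv x y in
    lazymatch b with true => true | false => lmod_mem x s' end
  end.
Ltac lmod_add x s :=
  let b := lmod_mem x s in
  lazymatch b with true => s | false => constr:(x :: s) end.
Ltac lmod_index x s :=
  lazymatch s with
  | ?y :: ?s' =>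
    let b := lmod_conv x y in
    lazymatch b with
    | true => constr:(0%N)
    | false => let i := lmod_index x s' in constr:(S i)
    end
  end.
Ltac lmod_atoms t s :=
  lazymatch t with
  | (?a + ?b)%R => let s1 := lmod_atoms a s in lmod_atoms b s1
  | (- ?a)%R => lmod_atoms a s
  | (_ *: ?a)%R => lmod_atoms a s
  | (?a *+ _)%R => lmod_atoms a s
  | 0%R => s
  | _ => lmod_add t s
  end.
Ltac lmod_reify R t s :=
  lazymatch t with
  | (?a + ?b)%R => let a' := lmod_reify R a s in
      let b' := lmod_reify R b s in constr:(@LAdd R a' b')
  | (- ?a)%R => let a' := lmod_reify R a s in constr:(@LOpp R a')
  | (?k *: ?a)%R => let a' := lmod_reify R a s in constr:(@LScale R k a')
  | (?a *+ ?n)%R => let a' := lmod_reify R a s in constr:(@LMuln R a' n)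
  | 0%R => constr:(@LZero R)
  | _ => let i := lmod_index t s in constr:(@LVar R i)
  end.
Ltac lmod :=
  lazymatch goal with
  | |- @eq ?T ?a ?b =>
    let U := open_constr:(@Riesz.sort _ _) in
    unify T U;
    lazymatch U with @Riesz.sort ?R ?V =>
    let s0 := lmod_atoms a (@nil (@Riesz.sort R V)) in
    let s := lmod_atoms b s0 in
    let a' := lmod_reify R a s in
    let b' := lmod_reify R b s in
    refine (@leval_eq R _ s a' b' _); rewrite /=; do ?split;
    solve [ring | field; by rewrite ?gt_eqF]
    end
  end.

(** * Order and lattice identities in a Riesz space *)

Section OrderedSpace.
Context {R : realType} {V : rieszType R}.
Implicit Types x y z a b c v : V.

Lemma vle_sub a b x y : a <= b -> y - x = b - a -> x <= y.
Proof.
move=> ab h; have := riesz_lerD2r (x - a) _ _ ab.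
rewrite addrC subrK; have -> : b + (x - a) = (b - a) + x by lmod.
by rewrite -h subrK.
Qed.

Lemma vleD a b c d : a <= b -> c <= d -> a + c <= b + d.
Proof.
move=> ab cd; apply: le_trans (riesz_lerD2r c _ _ ab) _.
by rewrite ![b + _]addrC; apply: riesz_lerD2r.
Qed.

Lemma vleZ (k : R) a b : 0 <= k -> a <= b -> k *: a <= k *: b.
Proof.
move=> k0 ab; have ba : 0 <= b - a by apply: vle_sub ab _; lmod.
by apply: vle_sub (riesz_scaler_ge0 _ _ k0 ba) _; lmod.
Qed.

End OrderedSpace.

(* Linear arithmetic with an explicit certificate: [h] is a combination of known inequalities whose
   two sides have the same difference as those of the goal. *)
Tactic Notation "vle" uconstr(h) :=
  (let H := fresh in have H := h; apply: (vle_sub H); clear H; lmod).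

Section RieszIdentities.
Context {R : realType} {V : rieszType R}.
Implicit Types x y z a b c v : V.

Lemma vge0D a b : 0 <= a -> 0 <= b -> 0 <= a + b.
Proof. by move=> a0 b0; vle (vleD a0 b0). Qed.

Lemma vsub_ge0 a b : (0 <= b - a) = (a <= b).
Proof. by apply/idP/idP => h; vle h. Qed.

Lemma vleN a b : (- a <= - b) = (b <= a).
Proof. by apply/idP/idP => h; vle h. Qed.

Lemma vleDr a b c : 0 <= c -> a <= b -> a <= b + c.
Proof. by move=> c0 ab; vle (vleD c0 ab). Qed.

Lemma vle_scale (k l : R) a : 0 <= a -> k <= l -> k *: a <= l *: a.
Proof.
move=> a0 kl; have lk : 0 <= l - k by rewrite subr_ge0.
by vle (vleZ lk a0).
Qed.

Lemma rjoin_l x y : x <= rjoin x y.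
Proof. by have := lexx (rjoin x y); rewrite rjoin_le => /andP[]. Qed.
Lemma rjoin_r x y : y <= rjoin x y.
Proof. by have := lexx (rjoin x y); rewrite rjoin_le => /andP[]. Qed.
Lemma rmeet_l x y : rmeet x y <= x.
Proof. by have := lexx (rmeet x y); rewrite le_rmeet => /andP[]. Qed.
Lemma rmeet_r x y : rmeet x y <= y.
Proof. by have := lexx (rmeet x y); rewrite le_rmeet => /andP[]. Qed.
Lemma rjoin_lub x y z : x <= z -> y <= z -> rjoin x y <= z.
Proof. by rewrite rjoin_le => -> ->. Qed.
Lemma rmeet_glb x y z : z <= x -> z <= y -> z <= rmeet x y.
Proof. by rewrite le_rmeet => -> ->. Qed.

Lemma rjoinC x y : rjoin x y = rjoin y x.
Proof. by apply/le_anti; rewrite !rjoin_le !rjoin_l !rjoin_r. Qed.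
Lemma rmeetC x y : rmeet x y = rmeet y x.
Proof. by apply/le_anti; rewrite !le_rmeet !rmeet_l !rmeet_r. Qed.

Lemma rjoin_eqr x y : x <= y -> rjoin x y = y.
Proof. by move=> xy; apply/le_anti; rewrite rjoin_r rjoin_lub. Qed.
Lemma rmeet_eql x y : x <= y -> rmeet x y = x.
Proof. by move=> xy; apply/le_anti; rewrite rmeet_l rmeet_glb. Qed.
Lemma rmeetxx x : rmeet x x = x. Proof. exact: rmeet_eql. Qed.

Lemma rjoinDr z x y : rjoin x y + z = rjoin (x + z) (y + z).
Proof.
apply/le_anti; rewrite rjoin_lub ?riesz_lerD2r ?rjoin_l ?rjoin_r// andbT.
have h : rjoin x y <= rjoin (x + z) (y + z) - z.
  by apply: rjoin_lub;
    [vle (rjoin_l (x + z) (y + z))|vle (rjoin_r (x + z) (y + z))].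
by vle h.
Qed.

Lemma rmeetDr z x y : rmeet x y + z = rmeet (x + z) (y + z).
Proof.
apply/le_anti; rewrite rmeet_glb ?riesz_lerD2r ?rmeet_l ?rmeet_r//=.
have h : rmeet (x + z) (y + z) - z <= rmeet x y.
  by apply: rmeet_glb;
    [vle (rmeet_l (x + z) (y + z))|vle (rmeet_r (x + z) (y + z))].
by vle h.
Qed.

Lemma rmeetN x y : rmeet (- x) (- y) = - rjoin x y.
Proof.
apply/le_anti/andP; split; last first.
  by apply: rmeet_glb; rewrite vleN ?rjoin_l ?rjoin_r.
rewrite -vleN opprK rjoin_lub// -vleN opprK; [exact: rmeet_l|exact: rmeet_r].
Qed.

Lemma rjoin_meet x y : rjoin x y = x + y - rmeet x y.
Proof.
have := rmeetN x y => /(congr1 (fun z => z + (x + y))).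
rewrite rmeetDr rmeetC.
have -> : - x + (x + y) = y by lmod.
have -> : - y + (x + y) = x by lmod.
by move=> ->; lmod.
Qed.

Lemma rabs_le x y : (rabs x <= y) = (x <= y) && (- x <= y).
Proof. exact: rjoin_le. Qed.
Lemma le_rabs x : x <= rabs x. Proof. exact: rjoin_l. Qed.
Lemma leN_rabs x : - x <= rabs x. Proof. exact: rjoin_r. Qed.
Lemma rabs_ge0 x : 0 <= rabs x.
Proof.
have h : 0 <= rabs x + rabs x by vle (vleD (le_rabs x) (leN_rabs x)).
have k : 0 <= 2^-1 :> R by lra.
by vle (vleZ k h).
Qed.
Lemma rabsN x : rabs (- x) = rabs x.
Proof. by rewrite /rabs opprK rjoinC. Qed.
Lemma rabs_pos x : 0 <= x -> rabs x = x.
Proof.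
move=> x0; apply/le_anti; rewrite le_rabs rabs_le lexx /= andbT.
by vle (vleD x0 x0).
Qed.
Lemma rabs_add x y : rabs (x + y) <= rabs x + rabs y.
Proof.
by rewrite rabs_le; apply/andP; split;
  [vle (vleD (le_rabs x) (le_rabs y))|vle (vleD (leN_rabs x) (leN_rabs y))].
Qed.
Lemma rabs_sub x y : rabs (x - y) <= rabs x + rabs y.
Proof. by rewrite -[rabs y]rabsN rabs_add. Qed.

Lemma meet0_sub a b : rmeet a b = 0 -> rjoin (a - b) 0 = a.
Proof.
move=> ab; have := rjoinDr (- b) a b; rewrite rjoin_meet ab subrr => <-; lmod.
Qed.
(** For [x = a - b] one has [|x| = (2x)^+ - x = 2 x^+ - x], and disjointness gives [x^+ = a]. *)
Lemma meet0_abs a b : rmeet a b = 0 -> rabs (a - b) = a + b.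
Proof.
move=> ab; have := rjoinDr (- (a - b)) ((a - b) + (a - b)) 0.
rewrite addrK add0r -/(rabs _) => <-.
have h2 : 0 <= 2 :> R by [].
have -> : rjoin (a - b + (a - b)) 0 = 2 *: rjoin (a - b) 0.
  apply/le_anti/andP; split.
    apply: rjoin_lub; last by vle (vleZ h2 (rjoin_r (a - b) 0)).
    by vle (vleZ h2 (rjoin_l (a - b) 0)).
  have h : rjoin (a - b) 0 <= 2^-1 *: rjoin (a - b + (a - b)) 0.
    have k : 0 <= 2^-1 :> R by lra.
    apply: rjoin_lub.
      by vle (vleZ k (rjoin_l (a - b + (a - b)) 0)).
    by vle (vleZ k (rjoin_r (a - b + (a - b)) 0)).
  by vle (vleZ h2 h).
by rewrite meet0_sub//; lmod.
Qed.

Definition rpos x := rjoin x 0.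

Lemma rpos_ge0 x : 0 <= rpos x. Proof. exact: rjoin_r. Qed.
Lemma le_rpos x : x <= rpos x. Proof. exact: rjoin_l. Qed.
Lemma rpos_le x y : 0 <= y -> x <= y -> rpos x <= y.
Proof. by move=> y0 xy; apply: rjoin_lub. Qed.
Lemma rpos_id x : 0 <= x -> rpos x = x.
Proof. by move=> x0; rewrite /rpos rjoinC rjoin_eqr. Qed.
Lemma rpos_sub x : rpos x - rpos (- x) = x.
Proof.
suff -> : rpos x = rpos (- x) + x by lmod.
by rewrite /rpos rjoinDr addNr add0r rjoinC.
Qed.
Lemma rposNE x : rpos (- x) = rpos x - x.
Proof. by rewrite -{3}(rpos_sub x); lmod. Qed.
Lemma rpos_disj x : rmeet (rpos x) (rpos (- x)) = 0.
Proof.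
suff: rmeet (rpos x) (rpos (- x)) + (x - rpos x) = x - rpos x.
  by move=> /(congr1 (fun z => z - (x - rpos x))); rewrite addrK subrr.
rewrite rmeetDr rposNE.
have -> : rpos x + (x - rpos x) = x by lmod.
have -> : rpos x - x + (x - rpos x) = 0 by lmod.
have := rmeetN (- x) 0; rewrite opprK oppr0 => ->.
by rewrite -/(rpos _) rposNE; lmod.
Qed.
Lemma rabsE x : rabs x = rpos x + rpos (- x).
Proof. by rewrite -{1}(rpos_sub x) meet0_abs // rpos_disj. Qed.
Lemma rpos_le_abs x : rpos x <= rabs x.
Proof. by rewrite rpos_le ?rabs_ge0 ?le_rabs. Qed.
Lemma rposN_le_abs x : rpos (- x) <= rabs x.
Proof. by rewrite rpos_le ?rabs_ge0 ?leN_rabs. Qed.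
Lemma meet0_pos a b : rmeet a b = 0 -> 0 <= a /\ 0 <= b.
Proof. by move=> <-; rewrite rmeet_l rmeet_r. Qed.

Lemma meet0_mono a b a' b' : 0 <= a' -> a' <= a -> 0 <= b' -> b' <= b ->
  rmeet a b = 0 -> rmeet a' b' = 0.
Proof.
move=> a0 aa b0 bb ab; apply/le_anti; rewrite rmeet_glb// andbT -ab.
by apply: rmeet_glb;
  [apply: le_trans (rmeet_l _ _) aa|apply: le_trans (rmeet_r _ _) bb].
Qed.

Lemma meet0D v a b : rmeet v a = 0 -> rmeet v b = 0 -> rmeet v (a + b) = 0.
Proof.
move=> va vb; have [v0 a0] := meet0_pos va; have [_ b0] := meet0_pos vb.
apply/le_anti; rewrite rmeet_glb ?vge0D// andbT.
set m := rmeet _ _.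
have mv : m <= v by exact: rmeet_l.
have mab : m <= a + b by exact: rmeet_r.
have mb : m - b <= 0.
  by rewrite -va; apply: rmeet_glb; [vle (vleD mv b0)|vle mab].
by rewrite -vb; apply: rmeet_glb => //; vle mb.
Qed.

Lemma meet0Mn v a n : rmeet v a = 0 -> rmeet v (a *+ n) = 0.
Proof.
move=> va; elim: n => [|n IH]; last by rewrite mulrS meet0D.
by have [v0 _] := meet0_pos va; rewrite mulr0n rmeetC rmeet_eql.
Qed.

Lemma vge0Mn a n : 0 <= a -> 0 <= a *+ n.
Proof. by move=> a0; elim: n => [|n IH]; rewrite ?mulr0n// mulrS vge0D. Qed.

Lemma supremums_le (A : set V) s x : supremums A s -> A x -> x <= s.
Proof. by move=> [ub _] /ub. Qed.
Lemma supremums_lub (A : set V) s x : supremums A s -> ubound A x -> s <= x.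
Proof. by move=> [_ lb] /lb. Qed.
Lemma infimums_le (A : set V) s x : infimums A s -> A x -> s <= x.
Proof. by move=> [ub _] /ub. Qed.
Lemma infimums_glb (A : set V) s x : infimums A s -> lbound A x -> x <= s.
Proof. by move=> [_ lb] /lb. Qed.

(** Put [m = s /\ v]. Every [x] in [A] is disjoint from [m], so [m + x] is the join of [m] and [x]
    and stays below [s]. Thus [s - m] bounds [A], which forces [m <= 0]. *)
Lemma meet0_sup (A : set V) s v : supremums A s ->
  (forall x, A x -> rmeet x v = 0) -> A !=set0 -> rmeet s v = 0.
Proof.
move=> sA h [x0 Ax0]; have [x00 v0] := meet0_pos (h _ Ax0).
set m := rmeet s v; apply/le_anti/andP; split; last first.
  by rewrite rmeet_glb// (le_trans x00)// (supremums_le sA).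
suff H : s <= s - m by vle H.
apply: (supremums_lub sA) => x Ax.
have mm : m + x <= s.
  suff -> : m + x = rjoin m x by rewrite rjoin_lub ?rmeet_l ?(supremums_le sA).
  rewrite rjoin_meet; suff -> : rmeet m x = 0 by rewrite subr0.
  have [xx0 _] := meet0_pos (h _ Ax).
  have m0 : 0 <= m by rewrite rmeet_glb// (le_trans x00)// (supremums_le sA).
  apply: (@meet0_mono v x m x) => //; first exact: rmeet_r.
  by rewrite rmeetC; exact: h.
by vle mm.
Qed.

Lemma supremums_neq0 (A : set V) : dedekind_complete V -> A !=set0 ->
  (exists y, ubound A y) -> exists s, supremums A s.
Proof. by move=> dc A0 [y Ay]; apply: dc; split => //; exists y. Qed.

Lemma infimums_neq0 (A : set V) : dedekind_complete V -> A !=set0 ->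
  (exists y, lbound A y) -> exists s, infimums A s.
Proof.
move=> dc [x Ax] [y Ay].
have [||s [su sl]] := @supremums_neq0 (lbound A) dc.
- by exists y.
- by exists x => z /(_ _ Ax).
exists s; split; last by move=> z /su.
by move=> z Az; apply: sl => t /(_ _ Az).
Qed.

Lemma supremumP (A : set V) : dedekind_complete V -> A !=set0 ->
  (exists y, ubound A y) -> supremums A (supremum 0 A).
Proof.
move=> dc A0 /(supremums_neq0 dc A0) [s sA]; rewrite /supremum.
case: ifPn => [/eqP A00|_]; last by apply: xgetPex; exists s.
by have := A0; rewrite A00 => -[].
Qed.

Lemma infimumP (A : set V) : dedekind_complete V -> A !=set0 ->
  (exists y, lbound A y) -> infimums A (infimum 0 A).
Proof.
move=> dc A0 /(infimums_neq0 dc A0) [s sA]; rewrite /infimum.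
case: ifPn => [/eqP A00|_]; last by apply: xgetPex; exists s.
by have := A0; rewrite A00 => -[].
Qed.

(** If [s] is the supremum of the multiples of [x], then [s - x] is still an upper bound of them. *)
Lemma archimedean_le0 x y :
  dedekind_complete V -> (forall n, x *+ n <= y) -> x <= 0.
Proof.
move=> dc h.
have [||s sA] := @supremums_neq0 (range (fun n => x *+ n)) dc.
- by exists (x *+ 0), 0%N.
- by exists y => _ [n _ <-].
suff H : s <= s - x by vle H.
apply: (supremums_lub sA) => _ [n _ <-].
have : x *+ n.+1 <= s by apply: (supremums_le sA); exists n.+1.
by rewrite mulrS => H; vle H.
Qed.

Lemma vle0_eps x y : dedekind_complete V ->
  (forall k : R, 0 < k -> x <= k *: y) -> x <= 0.
Proof.
move=> dc h; apply: (@archimedean_le0 x (rabs y) dc) => -[|n].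
  by rewrite mulr0n rabs_ge0.
have n0 : 0 < n.+1%:R :> R by rewrite ltr0n.
have k : 0 < n.+1%:R^-1 :> R by rewrite invr_gt0.
have := vleZ (ltW n0) (h _ k); rewrite scalerA divff ?gt_eqF// scale1r => H.
by apply: le_trans (le_rabs y); rewrite -scaler_nat.
Qed.

Lemma vle_eps x z y : dedekind_complete V ->
  (forall k : R, 0 < k -> x <= z + k *: y) -> x <= z.
Proof.
move=> dc h; rewrite -vsub_ge0 -[_ - _]opprB -oppr0 vleN.
by apply: (@vle0_eps _ y dc) => k /h H; vle H.
Qed.

End RieszIdentities.

(** * Components and f-algebras *)

Section Components.
Context {R : realType} {V : rieszType R}.
Implicit Types x y c d w : V.

Definition component (u c : V) : Prop := rmeet c (u - c) = 0.

(** For [w >= 0] this is the projection of [u] on the band generated by [w]; in a function space,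
    [u] restricted to {w > 0}. *)
Definition comp (u w : V) : V :=
  supremum 0 (range (fun n => rmeet u (w *+ n))).

Lemma component_bounds u c : component u c -> 0 <= c /\ c <= u.
Proof. by case/meet0_pos => c0; rewrite vsub_ge0. Qed.

Lemma componentC u c : component u c -> component u (u - c).
Proof.
rewrite /component rmeetC => h.
by have -> : u - (u - c) = c by lmod.
Qed.

Lemma component_sub u c d : component u c -> component u d -> d <= c ->
  component u (c - d).
Proof.
move=> uc ud dc; rewrite /component.
have [c0 cu] := component_bounds uc; have [d0 du] := component_bounds ud.
have -> : u - (c - d) = (u - c) + d by lmod.
have cd0 : 0 <= c - d by rewrite vsub_ge0.
apply: meet0D.
  apply: (@meet0_mono _ _ c (u - c)) => //; rewrite ?vsub_ge0 ?lexx//.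
  by vle d0.
rewrite rmeetC; apply: (@meet0_mono _ _ d (u - d)) => //.
by vle cu.
Qed.

Context (dc : dedekind_complete V) (u : V) (u0 : 0 <= u).

Lemma comp_sup w : supremums (range (fun n => rmeet u (w *+ n))) (comp u w).
Proof.
apply: supremumP => //; first by exists (rmeet u (w *+ 0)), 0%N.
by exists u => _ [n _ <-]; exact: rmeet_l.
Qed.

Lemma comp_le_unit w : comp u w <= u.
Proof. by apply: (supremums_lub (comp_sup w)) => _ [n _ <-]; exact: rmeet_l. Qed.

Lemma comp_ge w n : rmeet u (w *+ n) <= comp u w.
Proof. by apply: (supremums_le (comp_sup w)); exists n. Qed.

(** A part [d] of [u - c] lying below [k w] can be added to any [u /\ n w]: the sum is below both
    [u] and [(k + n) w], hence below [c]. So [c - d] is again an upper bound and [d] vanishes. *)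
Lemma compP w : 0 <= w -> component u (comp u w).
Proof.
move=> w0; apply: (meet0_sup (comp_sup w)); last first.
  by exists (rmeet u (w *+ 0)), 0%N.
move=> _ [k _ <-]; set c := comp u w; set d := rmeet _ (u - c).
have d1 : d <= rmeet u (w *+ k) by exact: rmeet_l.
have d2 : d <= u - c by exact: rmeet_r.
apply/le_anti/andP; split; last first.
  apply: rmeet_glb; last by rewrite vsub_ge0 comp_le_unit.
  by apply: rmeet_glb => //; apply: vge0Mn.
suff H : c <= c - d by vle H.
apply: (supremums_lub (comp_sup w)) => _ [n _ <-].
suff H : d + rmeet u (w *+ n) <= c by vle H.
apply: le_trans (comp_ge w (k + n)); apply: rmeet_glb.
  have cn : rmeet u (w *+ n) <= c by exact: comp_ge.
  by vle (vleD d2 cn).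
rewrite mulrnDr; apply: vleD (rmeet_r _ _).
exact: le_trans d1 (rmeet_r _ _).
Qed.

Lemma comp_disj w : 0 <= w -> rmeet w (u - comp u w) = 0.
Proof.
move=> w0; have uc : 0 <= u - comp u w by rewrite vsub_ge0 comp_le_unit.
apply/le_anti/andP; split; last exact: rmeet_glb.
rewrite -(compP w0); apply: rmeet_glb; last exact: rmeet_r.
apply: le_trans (comp_ge w 1); rewrite mulr1n rmeet_glb ?rmeet_l//.
by apply: le_trans (rmeet_r _ _) _; vle (component_bounds (compP w0)).1.
Qed.

Lemma comp_disj_of w v : rmeet v w = 0 -> rmeet v (comp u w) = 0.
Proof.
move=> vw; have [v0 w0] := meet0_pos vw; rewrite rmeetC.
apply: (meet0_sup (comp_sup w)); last by exists (rmeet u (w *+ 0)), 0%N.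
move=> _ [n _ <-]; rewrite rmeetC.
apply: (@meet0_mono _ _ v (w *+ n)) => //; last exact: meet0Mn.
  by rewrite rmeet_glb ?vge0Mn.
exact: rmeet_r.
Qed.

Lemma vleMn x y n : x <= y -> x *+ n <= y *+ n.
Proof. by move=> xy; elim: n => [|n IH]; rewrite ?mulr0n// !mulrS vleD. Qed.

Lemma comp_mono w w' : w <= w' -> comp u w <= comp u w'.
Proof.
move=> ww; apply: (supremums_lub (comp_sup w)) => _ [n _ <-].
apply: le_trans (comp_ge w' n); rewrite rmeet_glb ?rmeet_l//.
by apply: le_trans (rmeet_r _ _) _; apply: vleMn.
Qed.

End Components.

Section FAlgebra.
Context {R : realType} {W : rieszType R}.
Context {mul : W -> W -> W} {u : W} (H : falgebra_mul mul u).
Implicit Types x y z a b c w : W.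
Local Notation "x ** y" := (mul x y) (at level 40, left associativity).

Let mulDl := falg_mulDl H.
Let mulDr := falg_mulDr H.

Lemma fmul0l x : 0 ** x = 0.
Proof. by rewrite -[X in X ** _](scale0r 0) (falg_scalel H) scale0r. Qed.
Lemma fmul0r x : x ** 0 = 0.
Proof. by rewrite -[X in _ ** X](scale0r 0) (falg_scaler H) scale0r. Qed.
Lemma fmulNl x y : - x ** y = - (x ** y).
Proof. by rewrite -scaleN1r (falg_scalel H) scaleN1r. Qed.
Lemma fmulNr x y : x ** - y = - (x ** y).
Proof. by rewrite -scaleN1r (falg_scaler H) scaleN1r. Qed.
Lemma fmulBl x y z : (x - y) ** z = x ** z - y ** z.
Proof. by rewrite mulDl fmulNl. Qed.
Lemma fmulBr x y z : z ** (x - y) = z ** x - z ** y.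
Proof. by rewrite mulDr fmulNr. Qed.

Definition fexpand := (mulDl, mulDr, fmulNl, fmulNr, falg_scalel H,
  falg_scaler H, falg_mul1l H, falg_mul1r H).

Lemma fmul_le2l z x y : 0 <= z -> x <= y -> z ** x <= z ** y.
Proof.
move=> z0 xy; rewrite -vsub_ge0 -fmulBr.
by apply: (falg_mul_ge0 H); rewrite ?vsub_ge0.
Qed.
Lemma fmul_le2r z x y : 0 <= z -> x <= y -> x ** z <= y ** z.
Proof.
move=> z0 xy; rewrite -vsub_ge0 -fmulBl.
by apply: (falg_mul_ge0 H); rewrite ?vsub_ge0.
Qed.
Lemma fmul_ge0 x y : 0 <= x -> 0 <= y -> 0 <= x ** y.
Proof. exact: (falg_mul_ge0 H). Qed.

Lemma fmul_le2 x y z t :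
  0 <= x -> 0 <= z -> x <= y -> z <= t -> x ** z <= y ** t.
Proof.
move=> x0 z0 xy zt; apply: le_trans (fmul_le2r z0 xy) _.
by apply: fmul_le2l => //; apply: le_trans xy.
Qed.

Lemma fmul_disj a b : rmeet a b = 0 -> a ** b = 0.
Proof.
move=> ab; have [a0 b0] := meet0_pos ab.
have := falg_meetr H ab b0; rewrite rmeetC => h.
by have := falg_meetl H h a0; rewrite rmeetxx.
Qed.

Lemma fmul_meet0 a b c d :
  0 <= b -> 0 <= d -> rmeet a c = 0 -> rmeet (a ** b) (c ** d) = 0.
Proof.
move=> b0 d0 ac; apply: (falg_meetr H) => //.
by rewrite rmeetC; apply: (falg_meetr H) => //; rewrite rmeetC.
Qed.
Lemma fmul_meet0r a b c d :
  0 <= a -> 0 <= c -> rmeet b d = 0 -> rmeet (a ** b) (c ** d) = 0.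
Proof.
move=> b0 d0 ac; apply: (falg_meetl H) => //.
by rewrite rmeetC; apply: (falg_meetl H) => //; rewrite rmeetC.
Qed.

(** Expanding into positive and negative parts writes the product as a difference of two disjoint
    positive elements, whose sum is the product of the absolute values. *)
Lemma fmul_abs x y : rabs (x ** y) = rabs x ** rabs y.
Proof.
have [x0 nx0] := (rpos_ge0 x, rpos_ge0 (- x)).
have [y0 ny0] := (rpos_ge0 y, rpos_ge0 (- y)).
have [xd yd] := (rpos_disj x, rpos_disj y).
have -> : x ** y = (rpos x ** rpos y + rpos (- x) ** rpos (- y))
   - (rpos x ** rpos (- y) + rpos (- x) ** rpos y).
  by rewrite -{1}(rpos_sub x) -{1}(rpos_sub y) !fexpand; lmod.
rewrite meet0_abs ?rabsE ?fexpand; first by lmod.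
have [xd' yd'] :
    rmeet (rpos (- x)) (rpos x) = 0 /\ rmeet (rpos (- y)) (rpos y) = 0.
  by rewrite !(rmeetC (rpos (- _))).
by apply: meet0D; rewrite rmeetC; apply: meet0D;
  [exact: fmul_meet0r|exact: fmul_meet0|exact: fmul_meet0|exact: fmul_meet0r].
Qed.

Lemma fsqr_ge0 x : 0 <= x ** x.
Proof.
have -> : x ** x = rpos x ** rpos x + rpos (- x) ** rpos (- x).
  have d' : rmeet (rpos (- x)) (rpos x) = 0 by rewrite rmeetC rpos_disj.
  rewrite -{1 2}(rpos_sub x) !fexpand (fmul_disj (rpos_disj x)) (fmul_disj d').
  by lmod.
by apply: vge0D; apply: fmul_ge0; apply: rpos_ge0.
Qed.

Lemma fsqr_abs x : rabs x ** rabs x = x ** x.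
Proof. by rewrite -fmul_abs rabs_pos ?fsqr_ge0. Qed.

Lemma fcomp_id c x : rmeet x (u - c) = 0 -> c ** x = x.
Proof.
rewrite rmeetC => /fmul_disj; rewrite fmulBl (falg_mul1l H) => /eqP.
by rewrite subr_eq0 => /eqP <-.
Qed.

Section OneComponent.
Context (c : W) (uc : component u c).

Lemma fcomp_idem : c ** c = c.
Proof. exact: fcomp_id. Qed.

(** For [y >= 0], both [c y (u - c)] and [(u - c) y c] vanish by disjointness, so [c y] and [y c]
    both equal [c y c]. Full commutativity, [fmulC], is deduced from this case by localization. *)
Lemma fcomp_comm x : c ** x = x ** c.
Proof.
have [c0 cu] := component_bounds uc.
have uc0 : 0 <= u - c by rewrite vsub_ge0.
have P y : 0 <= y -> c ** y = y ** c.
  move=> y0; have h1 : c ** y ** (u - c) = 0.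
    by apply: fmul_disj; apply: (falg_meetr H).
  have h2 : (u - c) ** y ** c = 0.
    by apply: fmul_disj; apply: (falg_meetr H) => //; rewrite rmeetC.
  move: h1 h2; rewrite fmulBr (falg_mul1r H) => /eqP; rewrite subr_eq0 => /eqP ->.
  by rewrite !fmulBl (falg_mul1l H) => /eqP; rewrite subr_eq0 => /eqP ->.
by rewrite -(rpos_sub x) fmulBl fmulBr !P ?rpos_ge0.
Qed.

Lemma fcomp_le x : 0 <= x -> c ** x <= x.
Proof.
move=> x0; rewrite -[leRHS](falg_mul1l H); apply: fmul_le2r => //.
exact: (component_bounds uc).2.
Qed.

Lemma fcomp_ge0 x : 0 <= x -> 0 <= c ** x.
Proof. by apply: fmul_ge0; have [] := component_bounds uc. Qed.

Lemma fcomp_mulC x : c ** (c ** x) = c ** x.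
Proof. by rewrite (falg_mulA H) fcomp_idem. Qed.

End OneComponent.
End FAlgebra.

(** * Embeddings and localization on components *)

Section Embedding.
Context {R : realType} {V W : rieszType R}.
Context (iota : {linear V -> W}) (Hi : riesz_embedding iota).

Lemma iota_le x y : (iota x <= iota y) = (x <= y).
Proof.
apply/idP/idP => [h|/rjoin_eqr h].
  rewrite -[y](_ : rjoin x y = y) ?rjoin_l//; apply: (riesz_embedding_inj Hi).
  by rewrite (riesz_embeddingU Hi) rjoin_eqr.
by rewrite -h (riesz_embeddingU Hi) rjoin_l.
Qed.

Lemma iota_ge0 x : (0 <= iota x) = (0 <= x).
Proof. by rewrite -iota_le linear0. Qed.

Lemma iota_abs x : iota (rabs x) = rabs (iota x).
Proof. by rewrite /rabs (riesz_embeddingU Hi) linearN. Qed.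

Lemma iota_component u c : component u c -> component (iota u) (iota c).
Proof.
rewrite /component => h.
by rewrite -linearB -(riesz_embeddingI Hi) h linear0.
Qed.

Lemma iota_meet0 x y : rmeet x y = 0 -> rmeet (iota x) (iota y) = 0.
Proof. by move=> h; rewrite -(riesz_embeddingI Hi) h linear0. Qed.

End Embedding.

(** This closure keeps [comp e w] inside [K], so that localization inside the range of a conditional
    expectation uses only components of that range. *)
Definition seq_sup_closed {R : realType} {V : rieszType R} (K : set V) : Prop :=
  forall (y : nat -> V) s, (forall n, K (y n)) -> (forall n, y n <= y n.+1) ->
    supremums (range y) s -> K s.

Section Localization.
Context {R : realType} {V W : rieszType R}.
Context (iota : {linear V -> W}) (Hi : riesz_embedding iota).
Context (dcV : dedekind_complete V) (dcW : dedekind_complete W).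
Context {mul : W -> W -> W} {e : V} (e0 : 0 <= e).
Context (H : falgebra_mul mul (iota e)).
Context {K : set V} (rK : riesz_subspace K) (Ke : K e) (sK : seq_sup_closed K).
Local Notation "x ** y" := (mul x y) (at level 40, left associativity).
Local Notation u := (iota e).

Lemma riesz_subspaceB x y : K x -> K y -> K (x - y).
Proof.
move=> Kx Ky; apply: riesz_subspaceD => //.
by rewrite -scaleN1r; apply: riesz_subspaceZ.
Qed.

Lemma riesz_subspaceMn x n : K x -> K (x *+ n).
Proof. by move=> Kx; rewrite -scaler_nat; apply: riesz_subspaceZ. Qed.

Lemma riesz_subspace_pos x : K x -> K (rpos x).
Proof. by move=> Kx; apply: riesz_subspaceU => //; apply: riesz_subspace0. Qed.

Lemma comp_closed w : K w -> 0 <= w -> K (comp e w).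
Proof.
move=> Kw w0; refine (sK _ _ (comp_sup dcV e w)) => n.
  by apply: riesz_subspaceI => //; apply: riesz_subspaceMn.
rewrite rmeet_glb ?rmeet_l//; apply: le_trans (rmeet_r _ _) _.
by rewrite mulrSr; apply: vleDr.
Qed.

(* The components [k eps < a <= (k + 1) eps] exhaust the unit.                *)
Lemma localize (a : V) (z : W) (eps : R) : K a -> 0 <= a -> 0 < eps ->
  (forall c r, K c -> component e c -> 0 <= r ->
     r *: iota c <= iota c ** iota a ->
     iota c ** iota a <= (r + eps) *: iota c -> iota c ** z <= 0) ->
  z <= 0.
Proof.
move=> Ka a0 eps0 h.
(* [A k] is the component {a > k eps}; the slices are the differences [A k - A k.+1]. *)
pose y k := a - (k%:R * eps) *: e; pose A k := comp e (rpos (y k)).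
have u0 : 0 <= u by rewrite (iota_ge0 Hi).
have Ac k : component e (A k) by apply: compP => //; apply: rpos_ge0.
have Ac' k := iota_component Hi (Ac k).
have A0 k : 0 <= iota (A k) by have [] := component_bounds (Ac' k).
have KA k : K (A k).
  apply: comp_closed; last exact: rpos_ge0.
  by apply: riesz_subspace_pos; apply: riesz_subspaceB => //; apply: riesz_subspaceZ.
have AS k : A k.+1 <= A k.
  apply: comp_mono => //; apply: rpos_le; first exact: rpos_ge0.
  apply: le_trans (le_rpos _); rewrite /y -natr1.
  by vle (vleZ (ltW eps0) e0).
have lo k : (k%:R * eps) *: iota (A k) <= iota (A k) ** iota a.
  have : 0 <= iota (A k) ** iota (y k).
    rewrite -(rpos_sub (y k)) linearB (fmulBr H).
    rewrite (fmul_disj H (a := iota (A k)) (b := iota (rpos (- y k)))).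
      by rewrite subr0 (fmul_ge0 H)// (iota_ge0 Hi) rpos_ge0.
    apply: iota_meet0 => //; rewrite rmeetC; apply: comp_disj_of => //.
    by rewrite rmeetC rpos_disj.
  by rewrite /y linearB linearZ /= !(fexpand H) => G; vle G.
have hi k : (u - iota (A k)) ** iota a <= (k%:R * eps) *: (u - iota (A k)).
  have : (u - iota (A k)) ** iota (y k) <= 0.
    rewrite -(rpos_sub (y k)) linearB (fmulBr H).
    rewrite (fmul_disj H (a := u - iota (A k)) (b := iota (rpos (y k)))).
      rewrite sub0r -oppr0 vleN (fmul_ge0 H)// ?(iota_ge0 Hi) ?rpos_ge0//.
      by rewrite vsub_ge0; have [] := component_bounds (Ac' k).
    rewrite -linearB; apply: iota_meet0 => //; rewrite rmeetC; apply: comp_disj => //.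
    exact: rpos_ge0.
  by rewrite /y linearB linearZ /= !(fexpand H) => G; vle G.
(* The lowest slice is cut from the whole unit, since [A 0] misses the part where [a] vanishes. *)
have q0 : (u - iota (A 1)) ** z <= 0.
  rewrite -linearB; apply: (h _ 0) => //.
  - exact: riesz_subspaceB.
  - exact: componentC.
  - rewrite scale0r; apply: (fmul_ge0 H); rewrite (iota_ge0 Hi)// vsub_ge0.
    by have [] := component_bounds (Ac 1).
  - by rewrite linearB; have := hi 1; rewrite mul1r add0r.
have U0 k : 0 <= u - iota (A k).
  by rewrite vsub_ge0; have [] := component_bounds (Ac' k).
have e1 k : iota (A k) ** (u - iota (A k.+1)) = iota (A k - A k.+1).
  rewrite (fmulBr H) (falg_mul1r H) linearB (fcomp_id H)//.
  by apply: meet0_mono (Ac' k); rewrite ?(iota_le Hi).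
have e2 k : (u - iota (A k.+1)) ** iota (A k) = iota (A k - A k.+1).
  rewrite -e1 (fmulBl H) (fmulBr H) (falg_mul1l H) (falg_mul1r H).
  by rewrite (fcomp_comm H (Ac' k)).
have q k : (iota (A k) - iota (A k.+1)) ** z <= 0.
  rewrite -linearB; apply: (h _ (k%:R * eps)) => //.
  - exact: riesz_subspaceB.
  - exact: component_sub.
  - by rewrite mulr_ge0 ?ler0n ?ltW.
  - have := fmul_le2l H (U0 k.+1) (lo k).
    by rewrite (falg_scaler H) (falg_mulA H) e2.
  - have := fmul_le2l H (A0 k) (hi k.+1).
    by rewrite (falg_scaler H) (falg_mulA H) e1 -natr1 mulrDl mul1r.
have Q n : (u - iota (A n.+1)) ** z <= 0.
  elim: n => // n IH; have := vleD IH (q n.+1); rewrite !(fexpand H) => G; vle G.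
have zA n : z <= iota (A n.+1) ** rpos z.
  have := Q n; rewrite (fmulBl H) (falg_mul1l H) => G.
  have G' := fmul_le2l H (A0 n.+1) (le_rpos z).
  by vle (vleD G G').
have pA n : rpos z = iota (A n.+1) ** rpos z.
  apply/le_anti; rewrite (fcomp_le H (Ac' _)) ?rpos_ge0// andbT.
  by apply: rpos_le (zA n); apply: (fmul_ge0 H) => //; apply: rpos_ge0.
pose v := rmeet (rpos z) u.
have v0 : 0 <= v by rewrite rmeet_glb ?rpos_ge0.
have vA n : iota (A n.+1) ** v = v.
  apply/le_anti; rewrite (fcomp_le H (Ac' _))//=.
  have := fmul_le2l H (U0 n.+1) (rmeet_l (rpos z) u).
  by rewrite -/v !(fmulBl H) !(falg_mul1l H) -pA subrr => G; vle G.
(* The truncated positive part [v] of [z] lives in every [A n.+1], where [a] exceeds [(n + 1) eps];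
   so all multiples of [eps v] are below [a]. *)
have : eps *: v <= 0.
  apply: (@archimedean_le0 _ _ _ (iota a) dcW) => -[|n].
    by rewrite mulr0n (iota_ge0 Hi).
  have k0 : 0 <= n.+1%:R * eps by rewrite mulr_ge0 ?ltW// ltW.
  apply: le_trans (fcomp_le H (Ac' n.+1) (x := iota a) _); last first.
    by rewrite (iota_ge0 Hi).
  apply: le_trans (lo n.+1).
  have -> : (eps *: v) *+ n.+1 = (n.+1%:R * eps) *: v by lmod.
  apply: vleZ => //; rewrite -(vA n).
  have := fmul_le2l H (A0 n.+1) (rmeet_r (rpos z) u).
  by rewrite (falg_mul1r H).
have k1 : 0 <= eps^-1 by rewrite invr_ge0 ltW.
move=> /(vleZ k1); rewrite scalerA mulVf ?gt_eqF// scale1r scaler0 => v00.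
have vz : v = 0 by apply/le_anti; rewrite v0 v00.
have := fmul_disj H vz; rewrite (falg_mul1r H) => <-; exact: le_rpos.
Qed.

End Localization.

(** * Commutativity, squares and square roots *)

Section FAlgebraTheory.
Context {R : realType} {W : rieszType R}.
Context {mul : W -> W -> W} {u : W}.
Context (dcW : dedekind_complete W) (u0 : 0 <= u) (H : falgebra_mul mul u).
Implicit Types x y z a b c w : W.
Local Notation "x ** y" := (mul x y) (at level 40, left associativity).

Lemma flocalize a z (eps : R) : 0 <= a -> 0 < eps ->
  (forall c r, component u c -> 0 <= r -> r *: c <= c ** a ->
     c ** a <= (r + eps) *: c -> c ** z <= 0) ->
  z <= 0.
Proof.
move=> a0 eps0 h.
have Hid : riesz_embedding (idfun : {linear W -> W}) by [].
by apply: (localize Hid dcW dcW u0 H (K := setT) _ _ _ (a := a) (eps := eps))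
  => // c r _; apply: h.
Qed.

(** For positive factors, on a slice where [a] lies between [r] and [r + k], both [a b] and [b a]
    lie between [r b] and [(r + k) b]; they differ by at most [k b], for every [k > 0]. *)
Lemma fmulC x y : x ** y = y ** x.
Proof.
have P a b : 0 <= a -> 0 <= b -> a ** b - b ** a <= 0.
  move=> a0 b0; apply: (@vle0_eps _ _ _ b dcW) => k k0.
  rewrite -vsub_ge0 -vleN oppr0.
  apply: (@flocalize a _ k) => // c r uc r0 lo hi.
  have c0 := (component_bounds uc).1.
  have h1 := fmul_le2r H b0 hi.
  have h2 := fmul_le2l H b0 lo.
  move: h1 h2; rewrite !(fexpand H) (falg_mulA H b c) -(fcomp_comm H uc).
  by rewrite -!(falg_mulA H) => h1 h2; vle (vleD h1 h2).
have {}P a b : 0 <= a -> 0 <= b -> a ** b = b ** a.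
  by move=> a0 b0; apply/le_anti; rewrite -[_ <= _]vsub_ge0 -[X in _ && X]vsub_ge0
    -![0 <= _]vleN !oppr0 !opprB !P.
rewrite -(rpos_sub x) -(rpos_sub y) !(fexpand H).
by rewrite !(P (rpos x)) ?(P (rpos (- x))) ?rpos_ge0//; lmod.
Qed.

(** The square is the supremum of its tangents: on the slice at [r] the gap is [(a - r)^2], at most
    [k^2]. Positive linear maps fixing the unit respect the tangents, which yields Jensen in
    [cexp_sqr]. *)
Lemma fsqr_le_of_tangents a w : 0 <= a ->
  (forall r : R, (2 * r) *: a - (r * r) *: u <= w) -> a ** a <= w.
Proof.
move=> a0 h; apply: (@vle_eps _ _ _ _ u dcW) => e e0.
have [k k0 ke] : exists2 k : R, 0 < k & k * k <= e.
  exists (Num.sqrt e); first by rewrite sqrtr_gt0.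
  by rewrite -expr2 sqr_sqrtr// ltW.
suff : a ** a - (w + e *: u) <= 0 by move=> G; vle G.
apply: (@flocalize a _ k) => // c r uc r0 lo hi.
have [c0 cu] := component_bounds uc.
have d0 : 0 <= c ** a - r *: c by rewrite vsub_ge0.
have d1 : c ** a - r *: c <= k *: c by vle hi.
have := fmul_le2 H d0 d0 d1 d1.
rewrite !(fexpand H) (fcomp_idem H uc).
have -> : c ** a ** c = c ** a.
  by rewrite -(fcomp_comm H uc) (falg_mulA H) (fcomp_idem H uc).
have -> : c ** a ** (c ** a) = c ** (a ** a).
  rewrite (falg_mulA H) -(fcomp_comm H uc (c ** a)) (falg_mulA H).
  by rewrite (fcomp_idem H uc) -(falg_mulA H).
have -> : c ** (c ** a) = c ** a by rewrite (falg_mulA H) (fcomp_idem H uc).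
have := fmul_le2l H c0 (h r); rewrite !(fexpand H) => h1 h2.
by vle (vleD h1 (vleD h2 (vle_scale c0 ke))).
Qed.

Lemma fsqr_eq0 x : 0 <= x -> x ** x <= 0 -> x = 0.
Proof.
move=> x0 xx; apply/le_anti; rewrite x0 andbT.
apply: (@vle0_eps _ _ _ (2^-1 *: u) dcW) => k k0.
have := fsqr_ge0 H (x - k *: u); rewrite !(fexpand H) => G.
have k1 : 0 <= (2 * k)^-1 by rewrite invr_ge0 mulr_ge0// ltW.
have E1 : (2 * k)^-1 * (2 * k) = 1 by rewrite mulVf// mulf_neq0// gt_eqF.
have E2 : (2 * k)^-1 * (k * k) = k / 2 by field; rewrite gt_eqF.
have G' : (2 * k) *: x <= (k * k) *: u by vle (vleD G xx).
by have := vleZ k1 G'; rewrite !scalerA E1 E2 scale1r.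
Qed.

(** With [b = (a - s)^+], [b^2 (a + s) = b (a^2 - s^2) <= 0], while [b <= a + s]. Hence [b^3 <= 0],
    then [b^4 <= 0], and [fsqr_eq0] applied twice gives [b = 0]. *)
Lemma fsqr_le a s : 0 <= a -> 0 <= s -> a ** a <= s ** s -> a <= s.
Proof.
move=> a0 s0 as2; set b := rpos (a - s).
have b0 : 0 <= b by exact: rpos_ge0.
have ba : b <= a + s by apply: rpos_le; [exact: vge0D|vle (vleD s0 s0)].
have bb : b ** (a - s) = b ** b.
  rewrite -{1}(rpos_sub (a - s)) (fmulBr H).
  by rewrite (fmul_disj H (rpos_disj (a - s))) subr0.
have h : b ** b ** (a + s) <= 0.
  rewrite -bb -(falg_mulA H).
  have -> : (a - s) ** (a + s) = a ** a - s ** s.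
    by rewrite !(fexpand H) (fmulC s a); lmod.
  rewrite -(fmul0r H b); apply: (fmul_le2l H) => //.
  by vle as2.
have b20 := fmul_ge0 H b0 b0.
have b3 : b ** b ** b <= 0 by apply: le_trans h; apply: (fmul_le2l H).
have b4 : b ** b ** (b ** b) <= 0.
  rewrite -(fmul0l H b) (falg_mulA H); exact: (fmul_le2r H).
have b2 := fsqr_eq0 b20 b4.
have bz : b = 0 by apply: fsqr_eq0 => //; rewrite b2.
by have := le_rpos (a - s); rewrite -/b bz => G; vle G.
Qed.

(** The bound by [w + u] serves to place the root in the ideal [E] when [w] comes from [E]. *)
Lemma fsqrt_exists w : 0 <= w ->
  exists s : W, [/\ 0 <= s, s ** s = w & s <= w + u].
Proof.
move=> w0.
(* [sqrt w] is the infimum over [r > 0] of the means [(w / r + r) / 2].       *)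
pose F (r : R) := 2^-1 *: (r^-1 *: w + r *: u).
have half0 : 0 <= 2^-1 :> R by rewrite invr_ge0.
have F0 r : 0 < r -> 0 <= F r.
  move=> r0; apply: riesz_scaler_ge0 => //.
  have r1 := ltW r0; have ri : 0 <= r^-1 by rewrite invr_ge0.
  by apply: vge0D; apply: riesz_scaler_ge0.
have [||s sP] := @infimums_neq0 _ _ [set F r | r in [set r | 0 < r]] dcW.
- by exists (F 1), 1 => //=.
- by exists 0 => _ [r /= r0 <-]; exact: F0.
have s0 : 0 <= s by apply: (infimums_glb sP) => _ [r /= r0 <-]; exact: F0.
have sF r : 0 < r -> s <= F r by move=> r0; apply: (infimums_le sP); exists r.
have key c t (eps : R) : component u c -> 0 <= t -> 0 < eps ->
    t *: c <= c ** w -> c ** w <= (t + eps) *: c ->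
    t *: c <= c ** (s ** s) /\ c ** (s ** s) <= (t + eps) *: c.
  move=> uc t0 eps0 lo hi; have [c0 cu] := component_bounds uc.
  have te : 0 < t + eps by rewrite ltr_wpDl.
  set p := Num.sqrt t; set q := Num.sqrt (t + eps).
  have pp : p * p = t by rewrite -expr2 sqr_sqrtr.
  have qq : q * q = t + eps by rewrite -expr2 sqr_sqrtr// ltW.
  have q0 : 0 < q by rewrite sqrtr_gt0.
  have p0 : 0 <= p by rewrite sqrtr_ge0.
  have csE : c ** s ** (c ** s) = c ** (s ** s).
    rewrite (falg_mulA H) -(fcomp_comm H uc (c ** s)) (falg_mulA H).
    by rewrite (fcomp_idem H uc) -(falg_mulA H).
  (* On the slice [w <= q^2], so the mean at [r = q] is at most [q]. *)
  have up : c ** s <= q *: c.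
    have := fmul_le2l H c0 (sF _ q0); rewrite /F !(fexpand H) => G.
    have qi : 0 <= q^-1 by rewrite invr_ge0 ltW.
    have e1 : q^-1 *: ((q * q) *: c) = q *: c.
      by rewrite scalerA mulrA mulVf ?mul1r// gt_eqF.
    have := vleZ half0 (vleZ qi hi); rewrite -qq e1 => G2.
    by vle (vleD G G2).
  (* Arithmetic-geometric mean: [(t / r + r) / 2 - p = (p - r)^2 / (2 r)] with [p^2 = t]. *)
  have dn : p *: c <= c ** s.
    have h : p *: c <= s.
      apply: (infimums_glb sP) => _ [r /= r0 <-].
      have ri : 0 <= r^-1 by rewrite invr_ge0 ltW.
      have cw := le_trans lo (fcomp_le H uc w0).
      apply: le_trans (_ : 2^-1 *: (r^-1 *: (t *: c) + r *: c) <= _); last first.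
        by apply: vleZ => //; apply: vleD; apply: vleZ => //; apply: ltW.
      have G : 0 <= (2^-1 * r^-1) * ((p - r) * (p - r)).
        by rewrite -expr2 mulr_ge0 ?sqr_ge0// mulr_ge0.
      apply: (vle_sub (riesz_scaler_ge0 _ _ G c0)).
      have -> : 2^-1 / r * ((p - r) * (p - r)) = 2^-1 * r^-1 * t + 2^-1 * r - p.
        by rewrite -pp; field; rewrite gt_eqF.
      by lmod.
    by have := fmul_le2l H c0 h; rewrite (falg_scaler H) (fcomp_idem H uc).
  have pc0 : 0 <= p *: c by exact: riesz_scaler_ge0.
  have cs0 : 0 <= c ** s by exact: (fmul_ge0 H).
  have := fmul_le2 H pc0 pc0 dn dn; have := fmul_le2 H cs0 cs0 up up.
  by rewrite !(fexpand H) (fcomp_idem H uc) csE !scalerA pp qq.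
exists s; split => //; last first.
  apply: le_trans (sF _ ltr01) _; rewrite /F invr1 !scale1r.
  by vle (vleD (vleZ half0 w0) (vleZ half0 u0)).
have P1 : s ** s <= w.
  apply: (@vle_eps _ _ _ _ u dcW) => eps eps0.
  suff : s ** s - (w + eps *: u) <= 0 by move=> G; vle G.
  apply: (@flocalize w _ eps) => // c t uc t0 lo hi.
  have [_ h] := key _ _ _ uc t0 eps0 lo hi.
  by rewrite !(fexpand H); vle (vleD lo h).
apply/le_anti; rewrite P1 /=.
apply: (@vle_eps _ _ _ _ u dcW) => eps eps0.
suff : w - (s ** s + eps *: u) <= 0 by move=> G; vle G.
apply: (@flocalize w _ eps) => // c t uc t0 lo hi.
have [h _] := key _ _ _ uc t0 eps0 lo hi.
by rewrite !(fexpand H); vle (vleD hi h).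
Qed.

End FAlgebraTheory.

(** * The Riesz space as an ideal of its completion *)

Section Ideal.
Context {R : realType} {V W : rieszType R}.
Context (iota : {linear V -> W}) (Hi : riesz_embedding iota).
Context (dcV : dedekind_complete V).
Context (dense : forall y, 0 < y -> exists2 x, 0 < iota x & iota x <= y).

Lemma iota_gt0 x : (0 < iota x) = (0 < x).
Proof.
rewrite !lt_neqAle (iota_ge0 Hi) -[X in X == iota _](linear0 iota).
by rewrite (inj_eq (riesz_embedding_inj Hi)).
Qed.

(** The candidate is the supremum [s] in [E] of the elements below [y]. If [iota s] and [y]
    differed, density would put some [v > 0] of [E] inside the gap, and [s - v] or [s + v] would
    contradict the choice of [s]. *)
Lemma iota_ideal_ge0 x y : 0 <= y -> y <= iota x -> exists z, iota z = y.
Proof.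
move=> y0 yx; pose A := [set z | iota z <= y].
have [||s sA] := @supremums_neq0 _ _ A dcV.
- by exists 0; rewrite /A /= linear0.
- by exists x => z Az; rewrite -(iota_le Hi) (le_trans Az).
have dense' z t : ~~ (z <= t) -> exists2 v, 0 < v & iota v <= rpos (z - t).
  move=> zt; have /dense[v v0 vle] : 0 < rpos (z - t).
    rewrite lt_neqAle rpos_ge0 andbT; apply/eqP => e0; move/negP: zt; apply.
    by have := le_rpos (z - t); rewrite -e0 => G; vle G.
  by exists v => //; rewrite -iota_gt0.
have sy : iota s <= y.
  apply/negPn/negP => /dense' [v v0 vle].
  have /(lt_le_trans v0) : v <= 0; last by rewrite ltxx.
  suff H : s <= s - v by vle H.
  apply: (supremums_lub sA) => z Az; rewrite -(iota_le Hi) linearB.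
  have zs : iota z <= iota s by rewrite (iota_le Hi) (supremums_le sA).
  have h1 : rpos (iota s - y) <= iota s - iota z.
    by apply: rpos_le; [rewrite vsub_ge0|vle Az].
  by vle (le_trans vle h1).
exists s; apply/le_anti; rewrite sy /=.
apply/negPn/negP => /dense' [v v0 vle].
have /(lt_le_trans v0) : v <= 0; last by rewrite ltxx.
suff H : s + v <= s by vle H.
apply: (supremums_le sA); rewrite /A /= linearD.
rewrite rpos_id ?vsub_ge0// in vle.
by vle vle.
Qed.

Lemma iota_ideal x y : rabs y <= iota x -> exists z, iota z = y.
Proof.
move=> yx.
have [z1 e1] := iota_ideal_ge0 (rpos_ge0 y) (le_trans (rpos_le_abs y) yx).
have [z2 e2] := iota_ideal_ge0 (rpos_ge0 (- y)) (le_trans (rposN_le_abs y) yx).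
by exists (z1 - z2); rewrite linearB e1 e2 rpos_sub.
Qed.

End Ideal.

(** * Conditional expectations *)

Lemma linear_exists (R : nzRingType) (V W : lmodType R) (f : V -> W) :
  linear f -> exists g : {linear V -> W}, g =1 f.
Proof.
move=> lin; pose L := GRing.isLinear.Build R V W _ f lin.
by pose g : {linear V -> W} := HB.pack f L; exists g.
Qed.

Section ConditionalExpectations.
Context {R : realType} {E W : rieszType R}.
Context {iota : {linear E -> W}} {mul : W -> W -> W} {e : E}.
Context (Hi : riesz_embedding iota).
Context (dcE : dedekind_complete E) (dcW : dedekind_complete W).
Context (dense : forall y, 0 < y -> exists2 x, 0 < iota x & iota x <= y).
Context (e_unit : weak_order_unit e) (H : falgebra_mul mul (iota e)).
Implicit Types (S : {linear E -> E}) (x y z c : E).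
Local Notation "x ** y" := (mul x y) (at level 40, left associativity).

Let e0 : 0 <= e. Proof. by case: e_unit. Qed.
Let inj := riesz_embedding_inj Hi.

Lemma emulE x y : (exists z, iota z = iota x ** iota y) ->
  iota (emul iota mul x y) = iota x ** iota y.
Proof. exact: (@xgetPex _ 0 [set z | iota z = iota x ** iota y]). Qed.

Lemma mul_in_ideal x y z : rabs (iota x ** iota y) <= iota z ->
  exists t, iota t = iota x ** iota y.
Proof. exact: iota_ideal. Qed.

(** Since [|c x| <= |x|], the ideal property keeps the product in [E]. *)
Lemma cproj_exists c : component e c ->
  exists P : {linear E -> E}, forall x, iota (P x) = iota c ** iota x.
Proof.
move=> uc; have uc' := iota_component Hi uc.
have fE x : iota (emul iota mul c x) = iota c ** iota x.
  apply: emulE; apply: (@mul_in_ideal _ _ (rabs x)).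
  rewrite (fmul_abs H) (iota_abs Hi) rabs_pos; last by have [] := component_bounds uc'.
  by apply: (fcomp_le H uc'); exact: rabs_ge0.
have lin : linear (emul iota mul c).
  by move=> k x y; apply: inj; rewrite linearP !fE linearP !(fexpand H).
by have [P PE] := linear_exists lin; exists P => x; rewrite PE.
Qed.

Section ComponentProjection.
Context {c : E} {P : {linear E -> E}} (uc : component e c).
Context (PE : forall x, iota (P x) = iota c ** iota x).

Let uc' : component (iota e) (iota c) := iota_component Hi uc.

Lemma cproj_unit : P e = c.
Proof. by apply: inj; rewrite PE (falg_mul1r H). Qed.

Lemma cproj_ge0 x : 0 <= x -> 0 <= P x.
Proof.
by move=> x0; rewrite -(iota_ge0 Hi) PE (fcomp_ge0 H uc')// (iota_ge0 Hi).
Qed.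

Lemma cproj_mono x y : x <= y -> P x <= P y.
Proof. by rewrite -vsub_ge0 => h; rewrite -vsub_ge0 -linearB cproj_ge0. Qed.

Lemma cproj_le x : 0 <= x -> P x <= x.
Proof.
by move=> x0; rewrite -(iota_le Hi) PE (fcomp_le H uc')// (iota_ge0 Hi).
Qed.

Lemma cproj_idem x : P (P x) = P x.
Proof. by apply: inj; rewrite !PE (fcomp_mulC H uc'). Qed.

Lemma cproj_id x : rmeet x (e - c) = 0 -> P x = x.
Proof.
move=> xc; apply: inj; rewrite PE (fcomp_id H)//.
by have := iota_meet0 Hi xc; rewrite linearB.
Qed.

Lemma cproj_eq0 x : rmeet x c = 0 -> P x = 0.
Proof.
move=> xc; apply: inj; rewrite PE linear0 (fmul_disj H)//.
by apply: (iota_meet0 Hi); rewrite rmeetC.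
Qed.

Lemma cproj_disj x : 0 <= x -> rmeet (P x) (e - c) = 0.
Proof.
move=> x0; apply: inj; rewrite linear0 (riesz_embeddingI Hi) PE linearB.
by apply: (falg_meetr H); rewrite ?(iota_ge0 Hi)//; exact: uc'.
Qed.

Lemma cproj_disjC x : 0 <= x -> rmeet (x - P x) c = 0.
Proof.
move=> x0; apply: inj; rewrite linear0 (riesz_embeddingI Hi) linearB PE.
have -> : iota x - iota c ** iota x = (iota e - iota c) ** iota x.
  by rewrite (fmulBl H) (falg_mul1l H).
by apply: (falg_meetr H); rewrite ?(iota_ge0 Hi)// rmeetC; exact: uc'.
Qed.

Lemma cproj_abs x : rabs (P x) = P (rabs x).
Proof.
apply: inj; rewrite (iota_abs Hi) !PE (fmul_abs H) (iota_abs Hi).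
by rewrite [rabs (iota c)]rabs_pos//; have [] := component_bounds uc'.
Qed.

(** The band is the set of fixed points of [P]. The mixing coefficients quantify over abstract band
    projections, and this makes multiplications by components eligible there. *)
Lemma cproj_band : band_projection P.
Proof.
exists [set x | P x = x]; last first.
  move=> x; split; first exact: cproj_idem.
  move=> b /= Pb; rewrite /Defs.disjoint.
  have -> : rabs b = P (rabs b) by rewrite -cproj_abs Pb.
  have PR : P (rabs (x - P x)) = 0.
    by rewrite -cproj_abs linearB cproj_idem subrr rabs_pos.
  set t := rabs (x - P x) in PR *; have t0 : 0 <= t by exact: rabs_ge0.
  apply: inj; rewrite linear0 (riesz_embeddingI Hi) PE.
  have -> : iota t = (iota e - iota c) ** iota t.
    by rewrite (fmulBl H) (falg_mul1l H) -PE PR linear0 subr0.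
  apply: (fmul_meet0 H); rewrite ?(iota_ge0 Hi) ?rabs_ge0// rmeetC; exact: uc'.
have BE x : P x = x <-> P (rabs x) = rabs x.
  rewrite -cproj_abs; split => [->//|h].
  have xd : rabs x = rpos x + rpos (- x) by exact: rabsE.
  have := congr1 P xd; rewrite -cproj_abs h linearD {1}xd => h2.
  have [h3 h4] := (cproj_le (rpos_ge0 x), cproj_le (rpos_ge0 (- x))).
  have e1 : P (rpos x) = rpos x.
    have h5 : P (rpos x) = rpos x + rpos (- x) - P (rpos (- x)) by rewrite h2; lmod.
    by apply/le_anti; rewrite h3 /= h5; vle h4.
  have e2 : P (rpos (- x)) = rpos (- x).
    by move: h2; rewrite e1 => /addrI.
  by rewrite -(rpos_sub x) linearB e1 e2 rpos_sub.
have Bsol x y : P y = y -> rabs x <= rabs y -> P x = x.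
  move=> /BE Py xy; apply/BE; apply/le_anti; rewrite cproj_le ?rabs_ge0//=.
  have xy0 : 0 <= rabs y - rabs x by rewrite vsub_ge0.
  by have := cproj_le xy0; rewrite linearB Py => G; vle G.
have BD x y : P x = x -> P y = y -> P (x + y) = x + y.
  by move=> hx hy; rewrite linearD hx hy.
split => //=.
- split => //=.
  + exact: linear0.
  + by move=> k x hx; rewrite linearZ /= hx.
  + move=> x y hx hy; apply: (Bsol _ (rabs x + rabs y)).
      by apply: BD; apply: (BE _).1.
    rewrite (@rabs_pos _ _ (rabs x + rabs y)) ?vge0D ?rabs_ge0// rabs_le.
    apply/andP; split.
      by apply: rjoin_lub;
        [vle (vleD (le_rabs x) (rabs_ge0 y))|vle (vleD (le_rabs y) (rabs_ge0 x))].
    apply: (@le_trans _ _ (- x)); first by rewrite vleN rjoin_l.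
    by vle (vleD (leN_rabs x) (rabs_ge0 y)).
  + move=> x y hx hy; apply: (Bsol _ (rabs x + rabs y)).
      by apply: BD; apply: (BE _).1.
    rewrite (@rabs_pos _ _ (rabs x + rabs y)) ?vge0D ?rabs_ge0// rabs_le.
    apply/andP; split.
      apply: le_trans (rmeet_l _ _) _.
      by vle (vleD (le_rabs x) (rabs_ge0 y)).
    rewrite -vleN opprK; apply: rmeet_glb.
      by vle (vleD (leN_rabs x) (rabs_ge0 y)).
    by vle (vleD (leN_rabs y) (rabs_ge0 x)).
- move=> A s AB sA.
  (* A supremum of the empty set would be a least element, hence 0. *)
  have [[a Aa]|A0] := pselect (A !=set0); last first.
    have h x : s <= x by apply: (supremums_lub sA) => y Ay; case: A0; exists y.
    have s00 : s = 0.
      by apply/le_anti; rewrite h /=; vle (h (s + s)).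
    by rewrite s00 linear0.
  have as0 : 0 <= s - a by rewrite vsub_ge0 (supremums_le sA).
  have sP : s <= a + P (s - a).
    apply: (supremums_lub sA) => x Ax.
    have xs : x <= s by exact: (supremums_le sA).
    have := cproj_mono xs.
    by rewrite linearB (AB _ Ax : P x = x) (AB _ Aa : P a = a) => G; vle G.
  apply/eqP; rewrite -subr_eq0; apply/eqP/le_anti.
  have := cproj_le as0; rewrite linearB (AB _ Aa : P a = a) => G.
  rewrite linearB (AB _ Aa : P a = a) in sP.
  by apply/andP; split; [vle G|vle sP].
Qed.

End ComponentProjection.

(** What the supremum [s] misses, [y - s], is disjoint from the weak order unit [e]: a common part
    [d] of both could be added to every truncation, so that [s - d] would still bound them. *)
Lemma sup_trunc y : 0 <= y -> supremums (range (fun k => rmeet y (e *+ k))) y.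
Proof.
move=> y0.
have [||s sP] := @supremums_neq0 _ _ (range (fun k => rmeet y (e *+ k))) dcE.
- by exists (rmeet y (e *+ 0)), 0%N.
- by exists y => _ [k _ <-]; exact: rmeet_l.
suff ys : s = y by rewrite ys in sP.
have sy : s <= y by apply: (supremums_lub sP) => _ [k _ <-]; exact: rmeet_l.
have ys0 : 0 <= y - s by rewrite vsub_ge0.
have d0 : rmeet (y - s) e <= 0.
  set d := rmeet _ _.
  have d1 : d <= y - s by exact: rmeet_l.
  have d2 : d <= e by exact: rmeet_r.
  suff G : s <= s - d by vle G.
  apply: (supremums_lub sP) => _ [k _ <-].
  have : rmeet y (e *+ k) + d <= rmeet y (e *+ k.+1).
    apply: rmeet_glb.
      have ks : rmeet y (e *+ k) <= s by apply: (supremums_le sP); exists k.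
      by vle (vleD ks d1).
    by rewrite mulrSr; apply: vleD => //; exact: rmeet_r.
  have ks : rmeet y (e *+ k.+1) <= s by apply: (supremums_le sP); exists k.+1.
  by move=> G; vle (le_trans G ks).
have /eqP : y - s = 0.
  apply: e_unit.2; rewrite /Defs.disjoint !rabs_pos//.
  by apply/le_anti; rewrite d0 rmeet_glb.
by rewrite subr_eq0 => /eqP.
Qed.

Lemma directed_nat : directed_preorder (fun m n : nat => (m <= n)%N).
Proof.
split; [exact: (inhabits 0%N)|exact: leqnn|by move=> i j k; apply: leq_trans|].
by move=> i j; exists (maxn i j); rewrite leq_maxl leq_maxr.
Qed.

Section OneExpectation.
Context {S : {linear E -> E}} (cS : cond_exp S) (Se : S e = e).

Lemma cexp_mono x y : x <= y -> S x <= S y.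
Proof.
by rewrite -vsub_ge0 => h; rewrite -vsub_ge0 -linearB (cond_exp_ge0 cS).
Qed.

Lemma cexp_abs x : rabs (S x) <= S (rabs x).
Proof.
by rewrite rabs_le -linearN !cexp_mono ?le_rabs ?leN_rabs.
Qed.

Lemma range_cexp x : range S x <-> S x = x.
Proof.
split; last by exists x.
by case=> y _ <-; rewrite (cond_exp_idem cS).
Qed.

Lemma cexp_sup (y : nat -> E) s : (forall n, y n <= y n.+1) ->
  supremums (range y) s -> supremums (range (fun n => S (y n))) (S s).
Proof.
move=> yS sP; have ys n : y n <= s by apply: (supremums_le sP); exists n.
have ym m n : (m <= n)%N -> y m <= y n.
  elim: n => [|n IH]; first by rewrite leqn0 => /eqP ->.
  by rewrite leq_eqVlt => /predU1P[->//|/IH h]; exact: le_trans h _.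
have cv : order_cvg (fun m n : nat => (m <= n)%N) y s.
  exists (fun n => s - y n); split.
  - by move=> i j /ym ij; vle ij.
  - split; first by move=> _ [n _ <-]; rewrite vsub_ge0.
    move=> l ll; suff G : s <= s - l by vle G.
    apply: (supremums_lub sP) => _ [n _ <-].
    have G : l <= s - y n by apply: ll; exists n.
    by vle G.
  - by move=> n; rewrite -rabsN opprB rabs_pos ?vsub_ge0.
have [w [_ winf wb]] := cond_exp_ocont cS directed_nat cv.
split; first by move=> _ [n _ <-]; apply: cexp_mono.
move=> b bub; rewrite -vsub_ge0 -opprB -oppr0 vleN.
apply: (infimums_glb winf) => _ [n _ <-].
have h1 : S (y n) <= b by apply: bub; exists n.
have h2 := le_trans (leN_rabs _) (wb n).
by vle (vleD h1 h2).
Qed.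

Lemma seq_sup_closed_range : seq_sup_closed (range S).
Proof.
move=> y s Ky yS sP; apply/range_cexp.
have := cexp_sup yS sP.
have -> : (fun n => S (y n)) = y by apply: funext => n; apply/range_cexp.
move=> sP'; apply/le_anti.
by rewrite (supremums_lub sP' sP.1) (supremums_lub sP sP'.1).
Qed.

(** A truncation of [y] at [k e] is below [k c], so its image is below [k S c = k c], disjoint from
    [e - c]. Order continuity passes this to [y]. *)
Lemma cexp_disj c y : component e c -> S c = c -> rmeet y (e - c) = 0 ->
  rmeet (S y) (e - c) = 0.
Proof.
move=> uc Sc yc; have [y0 ec0] := meet0_pos yc.
have inc n : rmeet y (e *+ n) <= rmeet y (e *+ n.+1).
  rewrite rmeet_glb ?rmeet_l//; apply: le_trans (rmeet_r _ _) _.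
  by rewrite mulrSr; apply: vleDr.
have := cexp_sup inc (sup_trunc y0).
move=> sP; apply: (meet0_sup sP); last by exists (S (rmeet y (e *+ 0))), 0%N.
move=> _ [k _ <-]; set z := rmeet y _.
have z0 : 0 <= z by rewrite rmeet_glb// vge0Mn.
have [P PE] := cproj_exists uc.
have zc : z <= c *+ k.
  rewrite -(@cproj_id c P PE z).
    apply: le_trans (cproj_mono uc PE (rmeet_r _ _)) _.
    by rewrite linearMn (cproj_unit PE).
  by apply: meet0_mono yc => //; exact: rmeet_l.
rewrite rmeetC; apply: (@meet0_mono _ _ (e - c) (c *+ k)) => //.
- exact: (cond_exp_ge0 cS).
- by apply: le_trans (cexp_mono zc) _; rewrite linearMn Sc.
- by apply: meet0Mn; rewrite rmeetC.
Qed.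

(** [S] preserves the bands of [c] and of [e - c], hence the decomposition of [x] along them. *)
Lemma cexp_cproj c (P : {linear E -> E}) : component e c -> S c = c ->
  (forall x, iota (P x) = iota c ** iota x) -> forall x, S (P x) = P (S x).
Proof.
move=> uc Sc PE.
suff K x : 0 <= x -> S (P x) = P (S x).
  by move=> x; rewrite -(rpos_sub x) !linearB !K ?rpos_ge0.
move=> x0; have h1 := cexp_disj uc Sc (cproj_disj uc PE x0).
have Sc' : S (e - c) = e - c by rewrite linearB Se Sc.
have h2 : rmeet (S (x - P x)) c = 0.
  have cE : e - (e - c) = c by lmod.
  rewrite -{1}cE; apply: cexp_disj => //; first exact: componentC.
  by rewrite cE (cproj_disjC uc PE).
have -> : P (S x) = P (S (P x)) + P (S (x - P x)) by rewrite -!linearD addrC subrK.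
by rewrite (cproj_eq0 PE h2) addr0 (cproj_id PE h1).
Qed.

(** Localizing inside the range of [S], the components commute with [S] and [a] is constant up to
    [k] on them, so both sides agree up to [k S x]. *)
Lemma cexp_avg_ge0 a x z : S a = a -> 0 <= a -> 0 <= x ->
  iota z = iota a ** iota x -> iota (S z) = iota a ** iota (S x).
Proof.
move=> Sa a0 x0 zE.
have K k (c : E) r : 0 < k -> component e c -> S c = c ->
    r *: iota c <= iota c ** iota a -> iota c ** iota a <= (r + k) *: iota c ->
    iota c ** iota (S z) <= iota c ** (iota a ** iota (S x) + k *: iota (S x)) /\
    iota c ** (iota a ** iota (S x)) <= iota c ** (iota (S z) + k *: iota (S x)).
  move=> k0 uc Sc lo hi; have [P PE] := cproj_exists uc.
  have SP := cexp_cproj uc Sc PE.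
  have Sx0 : 0 <= S x by exact: (cond_exp_ge0 cS).
  have Pz1 : r *: P x <= P z.
    rewrite -(iota_le Hi) linearZ /= !PE zE (falg_mulA H) -(falg_scalel H).
    by apply: (fmul_le2r H) => //; rewrite (iota_ge0 Hi).
  have Pz2 : P z <= (r + k) *: P x.
    rewrite -(iota_le Hi) linearZ /= !PE zE (falg_mulA H) -(falg_scalel H).
    by apply: (fmul_le2r H) => //; rewrite (iota_ge0 Hi).
  have := cexp_mono Pz1; have := cexp_mono Pz2.
  rewrite !linearZ /= !SP -!(iota_le Hi) !linearZ /= !PE => h1 h2.
  have Sx0' : 0 <= iota (S x) by rewrite (iota_ge0 Hi).
  have h3 := fmul_le2r H Sx0' lo; have h4 := fmul_le2r H Sx0' hi.
  move: h3 h4; rewrite !(fexpand H) -!(falg_mulA H) => h3 h4.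
  by split; [vle (vleD h1 h3)|vle (vleD h2 h4)].
have rS := cond_exp_range cS; have cl := seq_sup_closed_range.
have Re : range S e by apply/range_cexp.
have Ra : range S a by apply/range_cexp.
apply/le_anti/andP; split; apply: (@vle_eps _ _ _ _ (iota (S x)) dcW) => k k0.
  suff : iota (S z) - (iota a ** iota (S x) + k *: iota (S x)) <= 0.
    by move=> G; vle G.
  apply: (localize Hi dcE dcW e0 H rS Re cl Ra a0 k0).
  move=> c r /range_cexp Sc uc r0 lo hi.
  have [h _] := K _ _ _ k0 uc Sc lo hi.
  by rewrite (fmulBr H); vle h.
suff : iota a ** iota (S x) - (iota (S z) + k *: iota (S x)) <= 0.
  by move=> G; vle G.
apply: (localize Hi dcE dcW e0 H rS Re cl Ra a0 k0).
move=> c r /range_cexp Sc uc r0 lo hi.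
have [_ h] := K _ _ _ k0 uc Sc lo hi.
by rewrite (fmulBr H); vle h.
Qed.

Lemma cexp_avg a x z : S a = a -> iota z = iota a ** iota x ->
  iota (S z) = iota a ** iota (S x).
Proof.
move=> Sa zE.
have Ra : range S a by apply/range_cexp.
have Sp : S (rpos a) = rpos a.
  by apply/range_cexp; exact: (riesz_subspace_pos (cond_exp_range cS) Ra).
have Sn : S (rpos (- a)) = rpos (- a).
  by rewrite rposNE linearB Sp Sa.
(* The four signed products lie in [E] because [|z| = |a| |x|] dominates them. *)
have ex b y : 0 <= b -> b <= rabs a -> 0 <= y -> y <= rabs x ->
    exists t, iota t = iota b ** iota y.
  move=> b0 ba y0 yx; apply: (@mul_in_ideal _ _ (rabs z)).
  rewrite (fmul_abs H) (iota_abs Hi) zE (fmul_abs H) -!(iota_abs Hi).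
  by apply: (fmul_le2 H); rewrite ?(iota_ge0 Hi) ?(iota_le Hi) ?rabs_ge0// rabs_pos.
have [[[p0 pa] n0] na] := (rpos_ge0 a, rpos_le_abs a, rpos_ge0 (- a), rposN_le_abs a).
have [t1 t1E] := ex _ _ p0 pa (rpos_ge0 x) (rpos_le_abs x).
have [t2 t2E] := ex _ _ p0 pa (rpos_ge0 (- x)) (rposN_le_abs x).
have [t3 t3E] := ex _ _ n0 na (rpos_ge0 x) (rpos_le_abs x).
have [t4 t4E] := ex _ _ n0 na (rpos_ge0 (- x)) (rposN_le_abs x).
have aE : iota a = iota (rpos a) - iota (rpos (- a)) by rewrite -linearB rpos_sub.
have -> : z = t1 - t2 - t3 + t4.
  apply: inj; rewrite linearD 2!linearB zE t1E t2E t3E t4E aE.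
  have -> : iota x = iota (rpos x) - iota (rpos (- x)) by rewrite -linearB rpos_sub.
  by rewrite !(fmulBr H) !(fmulBl H); lmod.
have -> : S (t1 - t2 - t3 + t4) = S t1 - S t2 - S t3 + S t4.
  by rewrite linearD 2!linearB.
rewrite linearD 2!linearB (cexp_avg_ge0 Sp _ _ t1E) ?rpos_ge0//.
rewrite (cexp_avg_ge0 Sp _ _ t2E) ?rpos_ge0//.
rewrite (cexp_avg_ge0 Sn _ _ t3E) ?rpos_ge0//.
rewrite (cexp_avg_ge0 Sn _ _ t4E) ?rpos_ge0// aE.
have -> : iota (S x) = iota (S (rpos x)) - iota (S (rpos (- x))).
  by rewrite -linearB -linearB rpos_sub.
by rewrite !(fmulBr H) !(fmulBl H); lmod.
Qed.

End OneExpectation.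
End ConditionalExpectations.

(** * Norms and mixing coefficients *)

Section OrderLimits.
Context {R : realType} {E : rieszType R}.
Implicit Types (x y z t : E) (S T : {linear E -> E}).

Lemma order_cvg_unique (I : Type) (leI : I -> I -> Prop) (x : I -> E) l l' :
  directed_preorder leI -> order_cvg leI x l -> order_cvg leI x l' -> l = l'.
Proof.
move=> dI; suff K a b : order_cvg leI x a -> order_cvg leI x b -> a <= b.
  by move=> xl xl'; apply/le_anti; rewrite !K.
move=> [u [ui uinf xu]] [v [vi vinf xv]].
have h i j : a - b <= u i + v j.
  have [k [ik jk]] := directed_ub dI i j.
  have h1 := vleD (le_trans (leN_rabs _) (xu k)) (ui _ _ ik).
  have h2 := vleD (le_trans (le_rabs _) (xv k)) (vi _ _ jk).
  by vle (vleD h1 h2).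
rewrite -vsub_ge0 -opprB -oppr0 vleN.
apply: (infimums_glb uinf) => _ [i _ <-].
have G : a - b - u i <= 0.
  by apply: (infimums_glb vinf) => _ [j _ <-]; vle (h i j).
by vle G.
Qed.

Lemma order_closed_range S : cond_exp S -> order_closed (range S).
Proof.
move=> cS I leI x l dI xS xl; apply/(range_cexp cS).
apply: (order_cvg_unique dI _ xl).
have := cond_exp_ocont cS dI xl; rewrite (_ : (fun i => S (x i)) = x)//.
by apply: funext => i; apply/(range_cexp cS).
Qed.

Lemma infimums0D_le0 (u v : nat -> E) t :
  (forall i j, (i <= j)%N -> u j <= u i) ->
  (forall i j, (i <= j)%N -> v j <= v i) ->
  infimums (range u) 0 -> infimums (range v) 0 ->
  (forall n, t <= u n + v n) -> t <= 0.
Proof.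
move=> ui vi uinf vinf h.
apply: (infimums_glb uinf) => _ [i _ <-].
suff G : t - u i <= 0 by vle G.
apply: (infimums_glb vinf) => _ [j _ <-].
have h1 := ui _ _ (leq_maxl i j); have h2 := vi _ _ (leq_maxr i j).
by vle (vleD (h (maxn i j)) (vleD h1 h2)).
Qed.

(** The assumption [0 <= b] covers the empty set, whose [supremum] is the default 0. *)
Lemma supremum0_le (A : set E) b : dedekind_complete E -> 0 <= b ->
  (forall x, A x -> x <= b) -> supremum 0 A <= b.
Proof.
move=> dc b0 h; have [A0|A0] := pselect (A !=set0).
  have sP := supremumP dc A0 (ex_intro _ _ h).
  exact: (supremums_lub sP).
rewrite (_ : A = set0) ?supremum0//.
by apply/seteqP; split => // x Ax; case: A0; exists x.
Qed.

Lemma le_supremum0 (A : set E) b x : dedekind_complete E ->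
  (forall x, A x -> x <= b) -> A x -> x <= supremum 0 A.
Proof.
move=> dc h Ax; have A0 : A !=set0 by exists x.
exact: (supremums_le (supremumP dc A0 (ex_intro _ _ h))).
Qed.

(** Two disjoint elements with a nonnegative sum are each nonnegative, as the negative part of one
    is below both absolute values. This applies to [P x] and [x - P x]. *)
Lemma band_projection_bounds (P : {linear E -> E}) x :
  band_projection P -> 0 <= x -> 0 <= P x /\ P x <= x.
Proof.
move=> [B bB PB] x0; have [BP dP] := PB x; have := dP _ BP.
rewrite /Defs.disjoint; set b := x - P x => d.
have sum : x = P x + b by rewrite /b; lmod.
have K (y z : E) : 0 <= y + z -> rmeet (rabs y) (rabs z) = 0 -> 0 <= y.
  move=> yz0 yz; have : rpos (- y) <= 0.
    rewrite -yz; apply: rmeet_glb; first exact: rposN_le_abs.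
    apply: rpos_le; first exact: rabs_ge0.
    by apply: le_trans (le_rabs z); vle yz0.
  by move=> h; have G := le_trans (le_rpos _) h; vle G.
have h1 : 0 <= P x by apply: (K _ b); rewrite -?sum// rmeetC.
split=> //; rewrite -vsub_ge0; apply: (K _ (P x)) => //.
by rewrite subrK.
Qed.

Lemma compatible_unit (T S : {linear E -> E}) e :
  T e = e -> compatible T S -> S e = e.
Proof. by move=> Te /(_ e)[]; rewrite Te. Qed.

End OrderLimits.

Section ConditionalNorms.
Context {R : realType} {E W : rieszType R}.
Context {iota : {linear E -> W}} {mul : W -> W -> W} {e : E}.
Context (Hi : riesz_embedding iota).
Context (dcE : dedekind_complete E) (dcW : dedekind_complete W).
Context (dense : forall y, 0 < y -> exists2 x, 0 < iota x & iota x <= y).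
Context (e_unit : weak_order_unit e) (H : falgebra_mul mul (iota e)).
Context {T : {linear E -> E}} (cT : cond_exp T) (Te : T e = e).
Implicit Types (S U V : {linear E -> E}) (x y z c g a : E).
Local Notation "x ** y" := (mul x y) (at level 40, left associativity).

Let e0 : 0 <= e. Proof. by case: e_unit. Qed.
Let u0 : 0 <= iota e. Proof. by rewrite (iota_ge0 Hi). Qed.
Let inj := riesz_embedding_inj Hi.

(** [P] is the projection on {y > 0}; its component belongs to the range of [S] with [y]. *)
Lemma pos_proj S y : cond_exp S -> S e = e -> S y = y ->
  exists c (P : {linear E -> E}), [/\ component e c, S c = c,
    forall x, iota (P x) = iota c ** iota x & P y = rpos y].
Proof.
move=> cS Se Sy; pose c := comp e (rpos y).
have uc : component e c by apply: compP => //; exact: rpos_ge0.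
have Ry : range S y by apply/(range_cexp cS).
have Re : range S e by apply/(range_cexp cS).
have rS := cond_exp_range cS.
have Sc : S c = c.
  apply/(range_cexp cS).
  apply: (comp_closed dcE rS Re (seq_sup_closed_range cS)); last exact: rpos_ge0.
  exact: (riesz_subspace_pos rS Ry).
have [P PE] := cproj_exists Hi dcE dense H uc.
exists c, P; split => //.
rewrite -{1}(rpos_sub y) linearB (cproj_id Hi H PE); last first.
  by apply: comp_disj => //; exact: rpos_ge0.
rewrite (cproj_eq0 Hi H PE) ?subr0//.
by apply: comp_disj_of => //; rewrite rmeetC rpos_disj.
Qed.

Lemma eq0_of_cproj S y :
  strictly_positive T -> cond_exp S -> S e = e -> S y = y ->
  (forall c (P : {linear E -> E}), component e c -> S c = c ->
     (forall x, iota (P x) = iota c ** iota x) -> T (P y) = 0) -> y = 0.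
Proof.
move=> Tpos cS Se Sy h.
have K z (k : R) : z = k *: y -> S z = z -> rpos z = 0.
  move=> zE Sz; have [c [P [uc Sc PE Pz]]] := pos_proj cS Se Sz.
  apply: Tpos; first exact: rpos_ge0.
  by rewrite -Pz zE !linearZ /= (h _ _ uc Sc PE) scaler0.
rewrite -(rpos_sub y) (K y 1) ?scale1r// (K (- y) (- 1)) ?scaleN1r ?subrr//.
by rewrite linearN Sy.
Qed.

(** For a component of R(U), hence of R(V), [P] commutes with both maps, so
    [T P U V x = T P x = T P U x]. Strict positivity, tested on {y > 0} and {y < 0} for
    [y = U V x - U x], gives [y = 0]. *)
Lemma cexp_tower U V : strictly_positive T -> cond_exp U -> cond_exp V ->
  compatible T U -> compatible T V -> range U `<=` range V ->
  forall x, U (V x) = U x.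
Proof.
move=> Tpos cU cV TU TV UV x.
have Ue := compatible_unit Te TU; have Ve := compatible_unit Te TV.
apply/eqP; rewrite -subr_eq0; apply/eqP.
apply: (eq0_of_cproj Tpos cU Ue); first by rewrite linearB !(cond_exp_idem cU).
move=> c P uc Uc PE.
have Vc : V c = c by apply/(range_cexp cV)/UV/(range_cexp cU).
have UP := cexp_cproj Hi dcE dense e_unit H cU Ue uc Uc PE.
have VP := cexp_cproj Hi dcE dense e_unit H cV Ve uc Vc PE.
by rewrite 2!linearB -!UP -VP !(proj2 (TU _)) (TV _).2 subrr.
Qed.

Lemma cexp_bounds S x : cond_exp S -> S e = e -> 0 <= x -> x <= e ->
  0 <= S x /\ S x <= e.
Proof.
move=> cS Se x0 xe; split; first exact: (cond_exp_ge0 cS).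
by rewrite -[leRHS]Se cexp_mono.
Qed.

Lemma cexp_component_bounds S c : cond_exp S -> S e = e -> component e c ->
  0 <= S c /\ S c <= e.
Proof. by move=> cS Se /component_bounds[c0 ce]; exact: cexp_bounds. Qed.

(** The common consequence of both mixing coefficients. A one-sided bound is enough, as only
    positive parts get estimated. *)
Definition mixing_bound U V a : Prop :=
  forall c d (P : {linear E -> E}), component e c -> U c = c ->
    (forall x, iota (P x) = iota c ** iota x) -> component e d -> V d = d ->
    T (P d) - emul iota mul (T c) (T d) <= a.

(** The constant 4 is a factor 2 used twice: [U x] and [h] have mean zero, so the mean of each
    absolute value is twice that of the positive part. *)
Lemma mixing_inequality U V x g a :
  cond_exp U -> cond_exp V -> compatible T U -> compatible T V ->
  V x = x -> T x = 0 -> T g = g -> rabs x <= g -> mixing_bound U V a ->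
  iota (T (rabs (U x))) <= 4 *: (iota g ** iota a).
Proof.
move=> cU cV TU TV Vx Tx Tg xg mix.
have Ue := compatible_unit Te TU; have Ve := compatible_unit Te TV.
have g0 : 0 <= g by apply: le_trans xg; exact: rabs_ge0.
have [c [P [uc Uc PE Px]]] := pos_proj cU Ue (cond_exp_idem cU x).
have UP := cexp_cproj Hi dcE dense e_unit H cU Ue uc Uc PE.
have [Vc0 Vce] := cexp_component_bounds cV Ve uc.
have [Tc0 Tce] := cexp_component_bounds cT Te uc.
have absE : T (rabs (U x)) = 2 *: T (P x).
  rewrite rabsE rposNE -Px -UP linearD linearB !(proj2 (TU _)) Tx; lmod.
set h := V c - T c.
have Vh : V h = h by rewrite linearB (cond_exp_idem cV) (TV _).1.
have Th : T h = 0 by rewrite linearB (TV _).2 (cond_exp_idem cT) subrr.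
have he : rabs h <= e + e.
  apply: le_trans (rabs_sub _ _) _; rewrite !rabs_pos//; exact: vleD.
have VPx : iota (V (P x)) = iota x ** iota (V c).
  apply: (cexp_avg Hi dcE dcW dense e_unit H cV Ve Vx).
  by rewrite PE (fmulC dcW u0 H).
(* This product has mean [T c] times [T x], which is 0; subtracting it replaces [V c] by
   [h = V c - T c]. *)
have [y' y'E] : exists y', iota y' = iota (T c) ** iota x.
  apply: (mul_in_ideal Hi dcE dense (z := rabs x)).
  rewrite (fmul_abs H) -!(iota_abs Hi) (rabs_pos Tc0).
  rewrite -[leRHS](falg_mul1l H); apply: (fmul_le2r H).
    by rewrite (iota_ge0 Hi) rabs_ge0.
  by rewrite (iota_le Hi).
have Ty' : T y' = 0.
  apply: inj.
  rewrite (cexp_avg Hi dcE dcW dense e_unit H cT Te (cond_exp_idem cT c) y'E).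
  by rewrite Tx linear0 (fmul0r H).
have ig0 : 0 <= iota g by rewrite (iota_ge0 Hi).
have [z zE] : exists z, iota z = iota g ** iota (rabs h).
  apply: (mul_in_ideal Hi dcE dense (z := g + g)).
  rewrite rabs_pos; last by apply: (fmul_ge0 H); rewrite ?(iota_ge0 Hi) ?rabs_ge0.
  have : iota (rabs h) <= iota (e + e) by rewrite (iota_le Hi).
  by move=> /(fmul_le2l H ig0); rewrite !linearD !(fexpand H).
have Tz := cexp_avg Hi dcE dcW dense e_unit H cT Te Tg zE.
have TPx : T (P x) <= T z.
  have -> : T (P x) = T (V (P x) - y') by rewrite linearB (TV _).2 Ty' subr0.
  apply: (cexp_mono cT); rewrite -(iota_le Hi) linearB VPx y'E.
  rewrite (fmulC dcW u0 H (iota (T c))) -(fmulBr H) -linearB zE.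
  apply: le_trans (le_rabs _) _.
  rewrite (fmul_abs H) -!(iota_abs Hi); apply: (fmul_le2r H).
    by rewrite (iota_ge0 Hi) rabs_ge0.
  by rewrite (iota_le Hi).
have [d [Q [ud Vd QE Qh]]] := pos_proj cV Ve Vh.
have VQ := cexp_cproj Hi dcE dense e_unit H cV Ve ud Vd QE.
have habs : T (rabs h) = 2 *: T (Q h).
  have -> : rabs h = 2 *: Q h - h by rewrite rabsE rposNE -Qh; lmod.
  by rewrite [T (_ - h)]linearB Th subr0 linearZ.
have TQh : T (Q h) <= a.
  apply: le_trans (mix c d P uc Uc PE ud Vd).
  have QcE : Q c = P d by apply: inj; rewrite PE QE (fmulC dcW u0 H).
  have QTc : iota (T (Q (T c))) = iota (T c) ** iota (T d).
    apply: (cexp_avg Hi dcE dcW dense e_unit H cT Te (cond_exp_idem cT c)).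
    by rewrite QE (fmulC dcW u0 H).
  have emE : emul iota mul (T c) (T d) = T (Q (T c)).
    by apply: inj; rewrite QTc; apply: emulE; exists (T (Q (T c))).
  by rewrite emE linearB -VQ linearB (TV _).2 QcE.
have Th2 : T (rabs h) <= 2 *: a by rewrite habs; apply: vleZ.
have := fmul_le2l H ig0 (_ : iota (T (rabs h)) <= iota (2 *: a)).
rewrite (iota_le Hi) => /(_ Th2); rewrite -Tz linearZ /= (falg_scaler H) => G1.
have := TPx; rewrite -(iota_le Hi) => G2.
rewrite absE linearZ /=.
have k2 : 0 <= 2 :> R by [].
by vle (vleZ k2 (vleD G1 G2)).
Qed.

Lemma cexp_sqr S y k :
  cond_exp S -> S e = e -> 0 <= y -> iota k = iota y ** iota y ->
  iota (S y) ** iota (S y) <= iota (S k).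
Proof.
move=> cS Se y0 kE; apply: (fsqr_le_of_tangents dcW u0 H).
  by rewrite (iota_ge0 Hi) (cond_exp_ge0 cS).
move=> r; have : (2 * r) *: y - (r * r) *: e <= k.
  rewrite -(iota_le Hi) linearB !linearZ /= kE.
  have := fsqr_ge0 H (iota y - r *: iota e); rewrite !(fexpand H) => G; vle G.
move=> /(cexp_mono cS); rewrite -(iota_le Hi) linearB !linearZ /= Se.
by rewrite linearD !linearZ /= linearN.
Qed.

Lemma Tnorm_infP x g : range_ge0 T g -> rabs x <= g ->
  [/\ rabs x <= Tnorm iota mul T ExpInf x,
      T (rabs x) <= Tnorm iota mul T ExpInf x
    & Tnorm iota mul T ExpInf x <= g].
Proof.
move=> Tg xg; rewrite /Tnorm; set A := [set g | _].
have lb : lbound A (rabs x) by move=> k [_].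
have AP : infimums A (infimum 0 A).
  by apply: infimumP => //; [exists g|exists (rabs x)].
split.
- exact: (infimums_glb AP).
- apply: (infimums_glb AP) => k [[/(range_cexp cT) Tk _] xk].
  by rewrite -Tk; apply: (cexp_mono cT).
- exact: (infimums_le AP).
Qed.

Lemma L1_le_Tnorm p S x : cond_exp S -> compatible T S ->
  Lspace iota mul T p x -> Lspace iota mul T ExpInf x ->
  T (rabs (x - S x)) <= Tnorm iota mul T p (x - S x).
Proof.
move=> cS TS; have Se := compatible_unit Te TS.
case: p => [//|[h hE] _|_ [g [Tg g0] xg]]; last first.
  have Sg : S g = g by move/(range_cexp cT): Tg => <-; rewrite (TS _).1.
  have TTg : range_ge0 T (g + g).
    split; last exact: vge0D.
    by apply/(range_cexp cT); rewrite linearD; move/(range_cexp cT): Tg => ->.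
  have [] // := @Tnorm_infP (x - S x) _ TTg.
  apply: le_trans (rabs_sub _ _) (vleD xg _).
  by apply: le_trans (cexp_abs cS _) _; rewrite -[leRHS]Sg cexp_mono.
set y := rabs (x - S x); have y0 : 0 <= y by exact: rabs_ge0.
have hE' : iota h = iota (rabs x) ** iota (rabs x).
  by rewrite hE (iota_abs Hi) (fsqr_abs H).
have x0 := rabs_ge0 x.
(* Here [y <= |x| + S |x|], so [y^2 <= 2 (x^2 + (S |x|)^2)], and Jensen bounds the last square by
   [S h]. *)
have [k kE] : exists k, iota k = iota y ** iota y.
  apply: (mul_in_ideal Hi dcE dense (z := 2 *: (h + S h))).
  rewrite rabs_pos ?(fsqr_ge0 H)//.
  set m := rabs x + S (rabs x).
  have ym : y <= m.
    by apply: le_trans (rabs_sub _ _) _; apply: vleD => //; exact: cexp_abs.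
  have iy0 : 0 <= iota y by rewrite (iota_ge0 Hi).
  rewrite -(iota_le Hi) in ym; apply: le_trans (fmul_le2 H iy0 iy0 ym ym) _.
  rewrite /m; have := cexp_sqr cS Se x0 hE'.
  have := fsqr_ge0 H (iota (rabs x) - iota (S (rabs x))).
  rewrite linearZ /= [iota (h + _)]linearD [iota (rabs x + _)]linearD hE'.
  rewrite !(fexpand H) => G1 G2.
  have k2 : 0 <= 2 :> R by [].
  by vle (vleD G1 (vleZ k2 G2)).
have kk : emul iota mul y y = k.
  by apply: inj; rewrite kE; apply: emulE; exists k.
have iTk0 : 0 <= iota (T k).
  by rewrite (iota_ge0 Hi) (cond_exp_ge0 cT)// -(iota_ge0 Hi) kE (fsqr_ge0 H).
have [s [s0 ss sle]] := fsqrt_exists dcW u0 H iTk0.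
rewrite -linearD in sle; have [t tE] := iota_ideal_ge0 Hi dcE dense s0 sle.
pose A := [set s | 0 <= s /\ iota s ** iota s = iota (T (emul iota mul y y))].
(* The root found in [E] shows that [xget] does not return its default. *)
have [s'0 s's] : A (Tnorm iota mul T Exp2 (x - S x)).
  apply: (@xgetPex _ 0 A); exists t; split; first by rewrite -(iota_ge0 Hi) tE.
  by rewrite tE kk.
rewrite -(iota_le Hi); apply: (fsqr_le dcW u0 H).
- by rewrite (iota_ge0 Hi) (cond_exp_ge0 cT).
- by rewrite (iota_ge0 Hi).
- by rewrite s's kk (cexp_sqr cT Te y0 kE).
Qed.

Section Coefficients.
Context {U V : {linear E -> E}} (cU : cond_exp U) (cV : cond_exp V).
Context (TU : compatible T U) (TV : compatible T V).

Let Ue : U e = e := compatible_unit Te TU.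
Let ee : 0 <= e + e := vge0D e0 e0.

Lemma band_projections_of_bounds S (P : {linear E -> E}) :
  band_projections_of e S P -> 0 <= P e /\ P e <= e.
Proof. by case=> bP _; apply: band_projection_bounds. Qed.

Lemma emul_unit_bounds x y : 0 <= x -> x <= e -> 0 <= y -> y <= e ->
  [/\ iota (emul iota mul x y) = iota x ** iota y,
      0 <= emul iota mul x y & emul iota mul x y <= e].
Proof.
move=> x0 xe y0 ye.
have p0 : 0 <= iota x ** iota y by apply: (fmul_ge0 H); rewrite (iota_ge0 Hi).
have pe : iota x ** iota y <= iota e.
  rewrite -[leRHS](falg_mul1l H).
  by apply: (fmul_le2 H); rewrite ?(iota_ge0 Hi) ?(iota_le Hi).
have E1 : iota (emul iota mul x y) = iota x ** iota y.
  by apply: emulE; apply: (mul_in_ideal Hi dcE dense (z := e)); rewrite rabs_pos.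
by split => //; [rewrite -(iota_ge0 Hi) E1|rewrite -(iota_le Hi) E1].
Qed.

Lemma le_alpha_set x : (exists P Q : {linear E -> E},
    [/\ band_projections_of e U P, band_projections_of e V Q
      & x = rabs (T (P (Q e)) - emul iota mul (T (P e)) (T (Q e)))]) ->
  x <= e + e.
Proof.
move=> [P [Q [UP VQ ->]]].
have [P0 Pe] := band_projections_of_bounds UP.
have [Q0 Qe] := band_projections_of_bounds VQ.
have [PQ0 PQe] := band_projection_bounds UP.1 Q0.
have [TP0 TPe] := cexp_bounds cT Te P0 Pe.
have [TQ0 TQe] := cexp_bounds cT Te Q0 Qe.
have [TPQ0 TPQe] := cexp_bounds cT Te PQ0 (le_trans PQe Qe).
have [_ m0 me] := emul_unit_bounds TP0 TPe TQ0 TQe.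
apply: le_trans (rabs_sub _ _) _; rewrite !rabs_pos//; exact: vleD.
Qed.

Lemma alpha_coef_le : alpha_coef iota mul T e U V <= e + e.
Proof. by apply: supremum0_le => // x; exact: le_alpha_set. Qed.

Lemma emul_cexp (P : {linear E -> E}) c d : component e c -> component e d ->
  (forall x, iota (P x) = iota c ** iota x) ->
  emul iota mul (T c) (T d) = T (P (T d)).
Proof.
move=> uc ud PE; apply: inj.
have [Tc0 Tce] := cexp_component_bounds cT Te uc.
have [Td0 Tde] := cexp_component_bounds cT Te ud.
have [-> _ _] := emul_unit_bounds Tc0 Tce Td0 Tde.
have E1 : iota (P (T d)) = iota (T d) ** iota c by rewrite PE (fmulC dcW u0 H).
rewrite (cexp_avg Hi dcE dcW dense e_unit H cT Te (cond_exp_idem cT d) E1).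
exact: (fmulC dcW u0 H).
Qed.

(** The bound is [T |b|] so as to be a nonnegative element of R(T); replacing [b] by it is allowed
    because the estimated difference is itself fixed by [T]. *)
Lemma mixing_bound_alpha b : alpha_coef iota mul T e U V <= b ->
  mixing_bound U V (T (rabs b)).
Proof.
move=> ab c d P uc Uc PE ud Vd.
have [Q QE] := cproj_exists Hi dcE dense H ud.
set x := _ - _; have xb : rabs x <= b.
  apply: le_trans ab; apply: (le_supremum0 dcE le_alpha_set); exists P, Q.
  rewrite /x (cproj_unit Hi H PE) (cproj_unit Hi H QE); split => //.
  - split; first exact: (cproj_band Hi H uc PE).
    by rewrite (cproj_unit Hi H PE); apply/(range_cexp cU).
  - split; first exact: (cproj_band Hi H ud QE).
    by rewrite (cproj_unit Hi H QE); apply/(range_cexp cV).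
have xT : T x = x by rewrite /x (emul_cexp uc ud PE) linearB !(cond_exp_idem cT).
rewrite -xT; apply: (cexp_mono cT).
exact: le_trans (le_rabs x) (le_trans xb (le_rabs b)).
Qed.

Lemma phi_arg_le (Q : {linear E -> E}) : band_projections_of e V Q ->
  rabs (U (Q e) - T (Q e)) <= e + e.
Proof.
move=> VQ; have [Q0 Qe] := band_projections_of_bounds VQ.
have [TQ0 TQe] := cexp_bounds cT Te Q0 Qe.
have [UQ0 UQe] := cexp_bounds cU Ue Q0 Qe.
apply: le_trans (rabs_sub _ _) _; rewrite !rabs_pos//; exact: vleD.
Qed.

Let range_ee : range_ge0 T (e + e).
Proof. by split => //; apply/(range_cexp cT); rewrite linearD Te. Qed.

Lemma le_phi_set x : (exists Q : {linear E -> E}, band_projections_of e V Q /\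
    x = Tnorm iota mul T ExpInf (U (Q e) - T (Q e))) -> x <= e + e.
Proof.
by move=> [Q [VQ ->]]; have [] := Tnorm_infP range_ee (phi_arg_le VQ).
Qed.

Lemma phi_coef_le : phi_coef iota mul T e U V <= e + e.
Proof. by apply: supremum0_le => // x; exact: le_phi_set. Qed.

(** Since [P] commutes with [U], the difference equals [T (P (U d - T d))], and [U d - T d] is below
    its norm, hence below [b]. *)
Lemma mixing_bound_phi b : phi_coef iota mul T e U V <= b ->
  mixing_bound U V (T (rabs b)).
Proof.
move=> pb c d P uc Uc PE ud Vd; rewrite (emul_cexp uc ud PE).
have [Q QE] := cproj_exists Hi dcE dense H ud.
have Qe := cproj_unit Hi H QE.
have VQ : band_projections_of e V Q.
  by split; [exact: (cproj_band Hi H ud QE)|rewrite Qe; apply/(range_cexp cV)].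
have UP := cexp_cproj Hi dcE dense e_unit H cU Ue uc Uc PE.
have -> : T (P d) = T (P (U d)) by rewrite -UP (TU _).2.
rewrite -linearB -linearB; apply: (cexp_mono cT).
apply: le_trans (cproj_mono Hi H uc PE (le_rabs _)) _.
apply: le_trans (cproj_le Hi H uc PE (rabs_ge0 _)) _; apply: le_trans (le_rabs b).
apply: le_trans pb; apply: (@le_trans _ _ (Tnorm iota mul T ExpInf (U d - T d))).
  by have := phi_arg_le VQ; rewrite Qe => /(Tnorm_infP range_ee)[].
by apply: (le_supremum0 dcE le_phi_set); exists Q; rewrite Qe.
Qed.

End Coefficients.
End ConditionalNorms.

(** * Monotonicity of the past *)

Section PastAndFuture.
Context {R : realType} {E : rieszType R}.
Context {T : {linear E -> E}} {TT : int -> int -> {linear E -> E}}.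
Implicit Types (S : int -> {linear E -> E}) (i j n : int).

Lemma range_sub_past S i n :
  is_past T TT S -> i <= n -> range (TT i n) `<=` range (S n).
Proof.
move=> /(_ n)[_ _ ->] iLn x xR; apply: sub_gen_smallest.
by exists i.
Qed.

Lemma range_sub_future S n j :
  is_future T TT S -> n <= j -> range (TT n j) `<=` range (S n).
Proof.
move=> /(_ n)[_ _ ->] nj x xR; apply: sub_gen_smallest.
by exists j.
Qed.

Lemma past_nondecreasing S : is_past T TT S ->
  (forall i j, i < j -> range (TT (i + 1) j) `<=` range (TT i j) /\
     range (TT i j) `<=` range (TT i (j + 1))) ->
  forall m n : int, m <= n -> range (S m) `<=` range (S n).
Proof.
move=> pS nested.
have step n : range (S n) `<=` range (S (n + 1)).
  have [cS _ _] := pS (n + 1); have [_ _ ->] := pS n.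
  apply: smallest_sub.
    by split; [exact: cond_exp_range|exact: order_closed_range].
  move=> x [i /= iLn xR].
  (* The right index may be raised only when [i < n]; for [i = n] the range of [TT n n] is first
     included in that of [TT (n - 1) n]. *)
  wlog i_n : i iLn xR / i < n => [hw|].
    have [|ni] := ltP i n; first exact: (hw i).
    have /eqP ein : i == n by rewrite eq_le iLn.
    have nn : n - 1 < n by lia.
    apply: (hw (n - 1)) => //; first exact: ltW.
    by apply: (nested _ _ nn).1; rewrite subrK; rewrite ein in xR.
  apply: (range_sub_past pS (i := i)); first by rewrite ler_wpDr.
  exact: (nested i n i_n).2.
move=> m n mn; have -> : n = m + `|n - m|%N%:Z by lia.
elim: `|n - m|%N => [|k IH]; first by rewrite addr0.
have -> : m + k.+1%:Z = m + k%:Z + 1 by lia.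
exact: subset_trans IH (step _).
Qed.

End PastAndFuture.

(** * The rate of the mixingale *)

Section MixingaleSequence.
Context {R : realType} {E : rieszType R}.
Implicit Types (e : E) (xi a : nat -> E).

(** The term in [m.-1] serves condition (ii), where the index is [m.+1]; the other two serve (i).
    For [m <= 1] the half index is 0, where [xi] is uncontrolled, and the unit [e] suffices because
    [|f n| <= g n]. *)
Definition mixingale_seq e xi a (m : nat) : E :=
  if (m <= 1)%N then e else xi m.-1 *+ 2 + xi m./2 + 4 *: a (m - m./2)%N.

Section Bounds.
Context {e : E} {xi a : nat -> E}.
Context (e0 : 0 <= e) (xi0 : forall m, (0 < m)%N -> 0 <= xi m).
Context (a0 : forall m, 0 <= a m).

Let k4 : 0 <= 4 :> R. Proof. by []. Qed.

Lemma mixingale_seq_ge0 m : 0 <= mixingale_seq e xi a m.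
Proof.
rewrite /mixingale_seq; case: leqP => // m1.
apply: vge0D; last exact: riesz_scaler_ge0.
by apply: vge0D; [apply: vge0Mn|]; apply: xi0; clear -m1; lia.
Qed.

Lemma mixingale_seqS_ge m : (0 < m)%N -> 2 *: xi m <= mixingale_seq e xi a m.+1.
Proof.
move=> m0; rewrite /mixingale_seq ifF; last by clear -m0; lia.
have h : 0 <= xi m.+1./2 by apply: xi0; clear -m0; lia.
have h4 := riesz_scaler_ge0 _ _ k4 (a0 (m.+1 - m.+1./2)%N).
by vle (vleD h h4).
Qed.

Lemma mixingale_seq_ge m : (1 < m)%N ->
  xi m./2 + 4 *: a (m - m./2)%N <= mixingale_seq e xi a m.
Proof.
move=> m1; rewrite /mixingale_seq ifF; last by clear -m1; lia.
have h : 0 <= xi m.-1 by apply: xi0; clear -m1; lia.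
by vle (vleD h h).
Qed.

Lemma mixingale_seq_cvg : seq_order_cvg xi 0 -> seq_order_cvg a 0 ->
  seq_order_cvg (mixingale_seq e xi a) 0.
Proof.
move=> [u [ui uinf xu]] [v [vi vinf av]].
have u0 n : 0 <= u n by apply: (infimums_le uinf); exists n.
have v0 n : 0 <= v n by apply: (infimums_le vinf); exists n.
have xiu m : xi m <= u m.
  by apply: le_trans (xu m); rewrite subr0 le_rabs.
have avm m : a m <= v m.
  by apply: le_trans (av m); rewrite subr0 le_rabs.
pose w m := u m + v m.
have w0 m : 0 <= w m by exact: vge0D.
have wi i j : (i <= j)%N -> w j <= w i.
  by move=> ij; apply: vleD; [exact: ui|exact: vi].
(* Both [m.-1] and [m - m./2] are at least [m./2] once [m > 1], so decreasing bounds at [m./2]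
   dominate every term. *)
exists (fun m => (if (m <= 1)%N then e else 0) + 4 *: w m./2); split.
- move=> i j ij; apply: vleD; last by apply: vleZ => //; exact/wi/half_leq.
  have [j1|_] := leqP j 1; first by rewrite (leq_trans ij).
  by case: ifP.
- split.
    move=> _ [m _ <-]; apply: vge0D; first by case: ifP.
    exact: riesz_scaler_ge0.
  move=> t lt; have k : 0 <= 4^-1 :> R by rewrite invr_ge0.
  suff G : 4^-1 *: t <= 0 by vle (vleZ k4 G).
  apply: (infimums0D_le0 ui vi uinf vinf) => n.
  have : t <= 0 + 4 *: w n.+1.
    by apply: lt; exists n.+1.*2 => //; rewrite doubleK doubleS.
  move=> G; have := wi _ _ (leqnSn n); rewrite {2}/w => G2.
  by vle (vleD (vleZ k G) G2).
- move=> m; rewrite subr0 rabs_pos ?mixingale_seq_ge0// /mixingale_seq.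
  case: leqP => m1; first by apply: vleDr => //; exact: riesz_scaler_ge0.
  have [m2 m3 m4] : [/\ (0 < m./2)%N, (m./2 <= m.-1)%N & (m./2 <= m - m./2)%N].
    by clear -m1; split; lia.
  have h1 := le_trans (xiu m.-1) (ui _ _ m3).
  have h2 := le_trans (avm _) (vi _ _ m4).
  have k2 : 0 <= 2 :> R by [].
  rewrite /w.
  by vle (vleD (vleD (vleZ k2 h1) (xiu m./2)) (vleD (vleZ k4 h2) (u0 m./2))).
Qed.

End Bounds.

Lemma seq_order_cvg_rabs (T : {linear E -> E}) a : cond_exp T ->
  seq_order_cvg a 0 -> seq_order_cvg (fun m => T (rabs (a m))) 0.
Proof.
move=> cT [u [ui uinf au]]; rewrite -[0](linear0 T).
apply: (cond_exp_ocont cT directed_nat); exists u; split => // i.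
by have := au i; rewrite !subr0 (rabs_pos (rabs_ge0 _)).
Qed.

End MixingaleSequence.

(** * The two mixingale inequalities *)

Theorem theorem4p10 (R : realType) (E Eu : rieszType R)
    (iota : {linear E -> Eu}) (mul : Eu -> Eu -> Eu)
    (T : {linear E -> E}) (e : E)
    (TT : int -> int -> {linear E -> E})
    (Tpast Tfuture : int -> {linear E -> E})
    (p : exponent) (f : int -> E)
    (E_complete : dedekind_complete E)
    (Eu_completion : universal_completion iota)
    (e_unit : weak_order_unit e) (Te : e = T e)
    (Eu_mul : falgebra_mul mul (iota e))
    (T_cond_exp : cond_exp T) (T_pos : strictly_positive T)
    (E_T_complete : T_universally_complete iota T)
    (TT_cond_exp : forall i j : int, i <= j ->
      cond_exp (TT i j) /\ compatible T (TT i j))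
    (TT_nested : forall i j : int, i < j ->
      range (TT (i + 1) j) `<=` range (TT i j) /\
      range (TT i j) `<=` range (TT i (j + 1)))
    (Tpast_def : is_past T TT Tpast)
    (Tfuture_def : is_future T TT Tfuture)
    (f_bounded : forall n, Lspace iota mul T ExpInf (f n))
    (f_ned : near_epoch_dependent iota mul T p f TT)
    (TT_mixing : alpha_mixing iota mul T e Tpast Tfuture \/
      phi_mixing iota mul T e Tpast Tfuture)
    (f_mean0 : forall n, T (f n) = 0) :
  mixingale iota mul T Exp1 f Tpast.
Proof.
have Hi := univ_compl_embedding Eu_completion.
have [dcW _] := univ_compl_complete Eu_completion.
have dense := univ_compl_dense Eu_completion.
have e0 : 0 <= e by case: e_unit.
have Te' : T e = e by [].
have cP n : cond_exp (Tpast n) by have [] := Tpast_def n.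
have TP n : compatible T (Tpast n) by have [] := Tpast_def n.
have cF n : cond_exp (Tfuture n) by have [] := Tfuture_def n.
have TF n : compatible T (Tfuture n) by have [] := Tfuture_def n.
have mono := past_nondecreasing Tpast_def TT_nested.
pose mix m b := forall n, mixing_bound (iota := iota) (mul := mul) (e := e)
  (T := T) (Tpast n) (Tfuture (n + m%:Z)) b.
have [a [Ta a0 acvg amix]] : exists a : nat -> E, [/\ forall m, T (a m) = a m,
    forall m, 0 <= a m, seq_order_cvg a 0 & forall m, mix m (a m)].
  (* Uniform bounds by [2 e] make the suprema over [n] genuine; then either coefficient yields one
     sequence [a] in R(T), independent of [n]. *)
  have reduce (F : int -> nat -> E) : (forall n m, F n m <= e + e) ->
      (forall m b, (forall n, F n m <= b) -> mix m (T (rabs b))) ->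
      seq_order_cvg (fun m => supremum 0 (range (F^~ m))) 0 ->
      exists a : nat -> E, [/\ forall m, T (a m) = a m,
        forall m, 0 <= a m, seq_order_cvg a 0 & forall m, mix m (a m)].
    move=> Fe mixF cv.
    exists (fun m => T (rabs (supremum 0 (range (F^~ m))))); split.
    - by move=> m; rewrite (cond_exp_idem T_cond_exp).
    - by move=> m; apply: (cond_exp_ge0 T_cond_exp); exact: rabs_ge0.
    - exact: seq_order_cvg_rabs.
    - move=> m; apply: mixF => n; apply: (le_supremum0 (b := e + e) E_complete).
        by move=> _ [k _ <-].
      by exists n.
  case: TT_mixing; apply: reduce => [n m|m b Fb n].
  - exact: (alpha_coef_le Hi E_complete dense e_unit Eu_mul T_cond_exp Te').
  - by apply: (mixing_bound_alpha Hi E_complete dcW dense e_unit Eu_mul T_cond_exp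
      Te' (cP n) (cF _) (Fb n)).
  - exact: (phi_coef_le E_complete e_unit T_cond_exp Te').
  - by apply: (mixing_bound_phi Hi E_complete dcW dense e_unit Eu_mul T_cond_exp
      Te' (cP n) (cF _) (TP n) (Fb n)).
have [f_p [d [xi [dL xiR xicvg ned]]]] := f_ned.
have d0 n : 0 <= d n by have [] := dL n.
have xi0 m : (0 < m)%N -> 0 <= xi m by move=> /xiR[].
have Txi m : (0 < m)%N -> T (xi m) = xi m.
  by move=> /xiR[/(range_cexp T_cond_exp)].
have /boolp.choice[g gP] :
    forall n, exists y : E, [/\ T y = y, 0 <= y & rabs (f n) <= y].
  move=> n; have [y [/(range_cexp T_cond_exp) Ty y0] fy] := f_bounded n.
  by exists y.
have approx n m : (0 < m)%N ->
    iota (T (rabs (f n - TT (n - m%:Z) (n + m%:Z) (f n)))) <=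
    mul (iota (d n)) (iota (xi m)).
  move=> m0; apply: le_trans (ned n m m0); rewrite (iota_le Hi).
  have [cTT TTT] :
      cond_exp (TT (n - m%:Z) (n + m%:Z)) /\ compatible T (TT (n - m%:Z) (n + m%:Z)).
    by apply: TT_cond_exp; clear; lia.
  exact: (L1_le_Tnorm Hi E_complete dcW dense e_unit Eu_mul T_cond_exp Te' cTT TTT
    (f_p n) (f_bounded n)).
have contr n x : T (rabs (Tpast n x)) <= T (rabs x).
  rewrite -[leRHS](TP n _).2; apply: (cexp_mono T_cond_exp).
  exact: (cexp_abs (cP n)).
split => //.
- split=> // m n mn x; split.
    exact: (cexp_tower Hi E_complete dense e_unit Eu_mul Te' T_pos (cP m) (cP n)
      (TP m) (TP n) (mono _ _ mn)).
  by apply/(range_cexp (cP n))/(mono _ _ mn); exists x.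
exists (fun n => d n + g n), (mixingale_seq e xi a); split.
- by move=> n; split => //; apply: vge0D; [|have [] := gP n].
- move=> m m0; split; last exact: mixingale_seq_ge0.
  rewrite /mixingale_seq; case: leqP => m1; first by exists e.
  have [p1 p2] : (0 < m.-1)%N /\ (0 < m./2)%N by clear -m1; lia.
  by apply/(range_cexp T_cond_exp); rewrite 2!linearD linearMn linearZ /= Ta !Txi.
- exact: mixingale_seq_cvg.
move=> n m m0; have [Tg g0 fg] := gP n.
have c0 : 0 <= d n + g n by exact: vge0D.
have dc : d n <= d n + g n by apply: vleDr.
have gc : g n <= d n + g n by rewrite addrC; apply: vleDr.
have mulm x y z t : 0 <= x -> 0 <= z -> x <= y -> z <= t ->
    mul (iota x) (iota z) <= mul (iota y) (iota t).
  move=> x0 z0 xy zt.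
  by apply: (fmul_le2 Eu_mul); rewrite ?(iota_ge0 Hi) ?(iota_le Hi).
have k2 : 0 <= 2 :> R by [].
have k4 : 0 <= 4 :> R by [].
rewrite /le_mul /Tnorm; split; last first.
  (* Condition (ii): [S] fixes [x], so the error of [S] is at most twice that of [x]. *)
  set S := Tpast (n + m%:Z); set x := TT (n - m%:Z) (n + m%:Z) (f n).
  have Sx : S x = x.
    apply/(range_cexp (cP _)).
    apply: (range_sub_past Tpast_def (i := n - m%:Z)); first by clear; lia.
    by exists (f n).
  have h1 : T (rabs (f n - S (f n))) <= 2 *: T (rabs (f n - x)).
    have -> : f n - S (f n) = (f n - x) - S (f n - x) by rewrite linearB Sx; lmod.
    apply: le_trans (cexp_mono T_cond_exp (rabs_sub _ _)) _; rewrite linearD.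
    by have G := contr (n + m%:Z) (f n - x); vle G.
  rewrite -(iota_le Hi) linearZ /= in h1.
  apply: le_trans h1 (le_trans (vleZ k2 (approx n m m0)) _).
  rewrite -(falg_scaler Eu_mul) -linearZ /=.
  apply: mulm => //; first by apply: riesz_scaler_ge0 => //; exact: xi0.
  exact: mixingale_seqS_ge.
have [m1|m1] := leqP m 1.
  rewrite /mixingale_seq m1 (falg_mul1r Eu_mul) (iota_le Hi).
  apply: le_trans (contr _ _) (le_trans _ gc).
  by rewrite -[leRHS]Tg; exact: (cexp_mono T_cond_exp).
have := mixingale_seq_ge (e := e) xi0 (a := a) m1.
set k := m./2 => seq_ge; have k0 : (0 < k)%N by rewrite /k; clear -m1; lia.
(* Condition (i): [x] is measurable for the future of [n - k], leaving a gap [m - k] after the past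
   of [n - m]; both [k] and [m - k] grow with [m]. *)
set U := Tpast (n - m%:Z); set x := TT (n - k%:Z) (n + k%:Z) (f n).
have [cTT TTT] :
    cond_exp (TT (n - k%:Z) (n + k%:Z)) /\ compatible T (TT (n - k%:Z) (n + k%:Z)).
  by apply: TT_cond_exp; clear; lia.
have Fx : Tfuture (n - k%:Z) x = x.
  apply/(range_cexp (cF _)).
  apply: (range_sub_future Tfuture_def (j := n + k%:Z)); first by clear; lia.
  by exists (f n).
have Tx : T x = 0 by rewrite (TTT _).2.
have xg : rabs x <= g n.
  apply: le_trans (cexp_abs cTT _) _.
  rewrite -[leRHS](_ : TT (n - k%:Z) (n + k%:Z) (g n) = g n); first exact: cexp_mono.
  by rewrite -Tg (TTT _).1.
have mb := amix (m - k)%N (n - m%:Z).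
have eidx : n - m%:Z + (m - k)%N%:Z = n - k%:Z by rewrite /k; clear; lia.
rewrite eidx in mb.
have h1 := mixing_inequality Hi E_complete dcW dense e_unit Eu_mul T_cond_exp Te'
  (cP _) (cF _) (TP _) (TF _) Fx Tx Tg xg mb.
have h2 : T (rabs (U (f n))) <= T (rabs (f n - x)) + T (rabs (U x)).
  have -> : U (f n) = U (f n - x) + U x by rewrite -linearD subrK.
  apply: le_trans (cexp_mono T_cond_exp (rabs_add _ _)) _; rewrite linearD.
  by apply: vleD => //; exact: contr.
rewrite -(iota_le Hi) linearD in h2.
have h3 := approx n k k0.
apply: le_trans h2 (le_trans (vleD h3 h1) _).
have x2 := xi0 _ k0.
have seq_ge0 : 0 <= xi k + 4 *: a (m - k)%N.
  by apply: vge0D => //; exact: riesz_scaler_ge0.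
apply: le_trans (mulm _ _ _ _ c0 seq_ge0 (lexx _) seq_ge).
rewrite [iota (xi k + _)]linearD linearZ /= (falg_mulDr Eu_mul) (falg_scaler Eu_mul).
by apply: vleD; [exact: mulm|apply: vleZ => //; exact: mulm].
Qed.
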